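(* Let $G$ be a planar graph that contains no kites and has maximum degree $\Delta(G)\geq 7$. Then $G$ has an edge $uv$ with $d(u)\leq 4$ and $d(u)+d(v)\leq \Delta(G)+2$.
   Context: All graphs are finite and without loops or multiple edges. $\Delta(G)$ denotes the maximum degree of $G$ and $d(v)$ the degree of the vertex $v$ in $G$. A kite is a subgraph formed by two (distinct) 3-cycles that share an edge; ''contains no kites'' means that no two distinct 3-cycles of $G$ share an edge. *)

(* Defs.v *)
From HB Require Import structures.
From mathcomp Require Import all_boot all_order all_algebra.
From mathcomp Require Import all_classical all_reals.
From mathcomp Require Import topology normedtype.

Set Implicit Arguments.
Unset Strict Implicit.
Unset Printing Implicit Defensive.

Import Order.TTheory GRing.Theory Num.Theory.
Import numFieldNormedType.Exports.

(* A finite simple graph is a symmetric irreflexive relation e on a finite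
   type V of vertices. *)
Section Graphs.
Variables (V : finType) (e : rel V).

Definition degree (v : V) : nat := #|[set w | e v w]|.

Definition max_degree : nat := \max_(v : V) degree v.

(* In a simple graph a 3-cycle is determined by its three vertices, and its
   edges are the pairs of distinct elements of that set. *)
Definition is_3cycle (T : {set V}) : Prop :=
  #|T| = 3 /\ forall x y, x \in T -> y \in T -> x != y -> e x y.

Definition kite_free : Prop :=
  forall T1 T2 : {set V}, is_3cycle T1 -> is_3cycle T2 -> T1 != T2 ->
  ~ exists u v, [/\ e u v, u \in T1 :&: T2 & v \in T1 :&: T2].

End Graphs.

Section Arcs.
Local Open Scope classical_set_scope.
Local Open Scope ring_scope.

Definition is_arc (R : realType) (x y : R * R) (A : set (R * R)) : Prop :=
  exists g : R -> R * R,
    [/\ {within `[0, 1], continuous g},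
        {in `[0, 1] &, injective g},
        g 0 = x, g 1 = y & A = g @` `[0, 1]].

End Arcs.

(* The arc of the edge uv is indexed by the unordered pair [set u; v], so that
   uv and vu are drawn by the same arc; values of [arc] at non-edges are
   irrelevant. The last two clauses say that the interior of an arc contains
   no vertex and no point of another arc. *)
Definition planar (R : realType) (V : finType) (e : rel V) : Prop :=
  exists (pt : V -> R * R) (arc : {set V} -> set (R * R)),
    [/\ injective pt,
        forall u v, e u v -> is_arc (pt u) (pt v) (arc [set u; v]),
        forall u v w, e u v -> arc [set u; v] (pt w) -> w = u \/ w = v
      & forall u v x y z, e u v -> e x y -> [set u; v] != [set x; y] ->
          arc [set u; v] z -> arc [set x; y] z -> exists w, z = pt w].

(* Main.v *)
Require Import Defs.
From HB Require Import structures.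
From mathcomp Require Import all_boot all_order all_algebra.
From mathcomp Require Import all_classical all_reals.
From mathcomp Require Import topology normedtype.
From mathcomp Require Import zify lra.
From mathcomp Require Import fintype fingraph finset.

(** Suppose that no edge is as claimed, and let [D] be the maximum degree.  Then
    every vertex that has a neighbour has degree at least 3, the neighbours of a
    vertex of degree 3 have degree [D], and those of a vertex of degree 4 have
    degree at least [D - 1].  A weighted count of edges and triangles shows that
    this is impossible.

    The only property of planarity that is used is [planar_bound]: a planar graph
    with [m] edges, [t] triangles and at least one vertex satisfies
    [2 m + 4 <= 4 n + t], where [n] counts any set of vertices that contains the
    ends of all edges.  In [star_bound] it is applied to the edges that meet a set
    [A] of vertices whose neighbours lie in a set [B] disjoint from [A], together
    with the edges that close a triangle with a vertex of [A]; in a kite-free graph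
    each triangle meeting [A] contributes its own such edge.  The inequality for
    the whole graph, taken six times, is added to [star_bound] for the vertices of
    degree 3, taken twice, and to [star_bound] for the vertices of degree 3 or 4,
    taken once.  A vertex of degree [d] is on at most [d / 2] triangles since there
    are no kites, and [vertex_charge] compares the two sides of the sum vertex by
    vertex: the side that should be the smaller one is at least as large as the
    other, even without the constant 4 of [planar_bound].

    The inequality [planar_bound] is proved without the Jordan curve theorem.  By
    compactness the initial thirds of the arcs that leave different vertices, and
    the middle thirds of different arcs, have positive distance; rounding the
    drawing to a fine grid therefore exhibits the graph as a minor of the grid
    ([edge_link], [block_connect]).  Call two grid cells equivalent when one can pass
    from one to the other across grid edges that do not belong to the minor; the
    classes are the faces.  The edges with exactly one side in a given face form an
    even set, each edge occurs in at most two of these sets, and they generate all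
    even edge sets, because a cycle of the grid bounds a set of cells
    ([torus_fill]).  The space of even edge sets has dimension at least
    [m - n + 1], so that many of these sets are linearly independent.  They are
    distinct and nonempty, hence have at least four elements each, except for at
    most [t] of them which are triangles.  Thus [4 (m - n + 1) - t <= 2 m], which is
    [sparse_bound]. *)

Set Implicit Arguments.
Unset Strict Implicit.
Unset Printing Implicit Defensive.

Import Order.TTheory GRing.Theory Num.Theory.
Import numFieldNormedType.Exports.

(** * Even edge sets and sparse spanning families *)

(** Edge sets are handled as vectors over the field with two elements, which
    is the type [bool] with exclusive or as addition.  The even edge sets are
    the members of the cycle space. *)
Definition edge_even (V : finType) (Z : {set {set V}}) : Prop :=
  forall v, (\sum_(X in Z) (v \in X : bool) = 0 :> bool)%R.

Definition triangle_in (V : finType) (Es : {set {set V}}) : {set {set V}} :=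
  [set T : {set V} | (#|T| == 3) &&
     [forall x in T, forall y in T, (x != y) ==> ([set x; y] \in Es)]].

Section SmallEven.
Variables (V : finType) (Es : {set {set V}}).
Hypothesis card_edge : forall X, X \in Es -> #|X| = 2.

(** Parity alone: an even set has no vertex lying on exactly one of its
    edges. *)
Lemma even_other (C : {set {set V}}) (v : V) (X : {set V}) :
  edge_even C -> X \in C -> v \in X -> exists2 Y, Y \in C :\ X & v \in Y.
Proof.
move=> ev XC vX; have := ev v; rewrite (big_setD1 X) //= vX => /eqP.
have [Y /andP[YC vY]|no] := pickP [pred Y | (Y \in C :\ X) && (v \in Y)].
  by move=> _; exists Y.
by rewrite big1 // => Y YC; have := no Y; rewrite /= YC /= => ->.
Qed.

Lemma other_end (X : {set V}) v :
  X \in Es -> v \in X -> exists2 w, w != v & X = [set v; w].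
Proof.
move=> XE vX; have /eqP/cards2P[x [y [xy eX]]] := card_edge XE.
move: vX; rewrite eX !inE => /orP[] /eqP ->.
  by exists y => //; rewrite eq_sym.
by exists x => //; rewrite setUC.
Qed.

Lemma set2_eqr (x y z : V) : [set x; y] = [set x; z] -> y = z.
Proof.
move=> e; have := set22 x y; rewrite e !inE => /orP[]/eqP // yx.
by have := set22 x z; rewrite -e yx !inE orbb => /eqP ->.
Qed.

(** Follow the edges of [C] from [u]: each time the walk enters a vertex,
    evenness provides another edge of [C] to leave by.  After three edges the
    walk is either back at [u], having traced a triangle, or at a fourth vertex,
    which needs a fourth edge. *)
Lemma even_small (C : {set {set V}}) :
  C \subset Es -> edge_even C -> C != set0 ->
  4 <= #|C| \/ exists u v w, [/\ u != v, v != w, u != w &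
       C = [set [set u; v]; [set v; w]; [set w; u]]].
Proof.
move=> /subsetP sC ev /set0Pn[X XC].
have /eqP/cards2P[u [v [uv eX]]] := card_edge (sC _ XC).
have vX : v \in X by rewrite eX set22.
have [Y] := even_other ev XC vX.
rewrite in_setD1 => /andP[YX YC] vY.
have [w wv eY] := other_end (sC _ YC) vY.
have wu : w != u by apply: contraNneq YX => wu; rewrite eY eX wu setUC.
have wY : w \in Y by rewrite eY set22.
have [Z] := even_other ev YC wY.
rewrite in_setD1 => /andP[ZY ZC] wZ.
have [x xw eZ] := other_end (sC _ ZC) wZ.
have xv : x != v by apply: contraNneq ZY => xv; rewrite eZ eY xv setUC.
have XZ : X != Z.
  by apply: contraTneq wZ => <-; rewrite eX !inE negb_or wu wv.
have sub3 : [set X; Y; Z] \subset C.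
  by apply/subsetP => W; rewrite !inE -orbA => /or3P[]/eqP->.
have c3 : #|[set X; Y; Z]| = 3.
  by rewrite setUC cardsU1 cards2 !inE negb_or eq_sym (eq_sym X Y) XZ ZY YX.
have [xu|xu] := eqVneq x u.
  case: (ltnP 3 #|C|) => [|le3]; first by left.
  right; exists u, v, w; split=> //; rewrite 1?eq_sym //.
  by rewrite -eX -eY -xu -eZ; apply/eqP; rewrite eq_sym eqEcard sub3 c3.
left.
have xZ : x \in Z by rewrite eZ set22.
have [W] := even_other ev ZC xZ.
rewrite in_setD1 => /andP[WZ WC] xW.
have WX : W != X.
  by apply: contraTneq xW => ->; rewrite eX !inE negb_or xu xv.
have WY : W != Y.
  by apply: contraTneq xW => ->; rewrite eY !inE negb_or xw xv.
have : W |: [set X; Y; Z] \subset C by rewrite subUset sub1set WC.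
by move/subset_leq_card; rewrite cardsU1 c3 !inE !negb_or WX WY WZ.
Qed.

Lemma card_triangle_edges (u v w : V) : u != v -> v != w -> u != w ->
  #|[set [set u; v]; [set v; w]; [set w; u]]| = 3.
Proof.
move=> uv vw uw; rewrite setUC cardsU1 cards2 !inE negb_or.
have -> : [set w; u] != [set u; v].
  by apply: contraNneq vw; rewrite setUC => /set2_eqr ->.
have -> : [set w; u] != [set v; w].
  by apply: contraNneq uv => /esym; rewrite setUC => /set2_eqr ->.
suff -> : [set u; v] != [set v; w] by [].
by apply: contraNneq uw; rewrite setUC => /set2_eqr ->.
Qed.

Lemma triangle_edges (C : {set {set V}}) (u v w : V) :
  u != v -> v != w -> u != w ->
  C = [set [set u; v]; [set v; w]; [set w; u]] -> C \subset Es ->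
  cover C \in triangle_in Es /\ C = [set X in Es | X \subset cover C].
Proof.
move=> uv vw uw eC sC.
have -> : cover C = [set u; v; w].
  by rewrite /cover eC !bigcup_setU !big_set1; apply/setP=> x; rewrite !inE; 
    case: (x == u); case: (x == v); case: (x == w).
have eqE x y : x \in [set u; v; w] -> y \in [set u; v; w] -> x != y -> [set x; y] \in C.
  rewrite eC !inE -!orbA.
  by do 2!case/or3P => /eqP ->; rewrite ?eqxx ?orbT //; rewrite 1?setUC ?eqxx ?orbT.
split; last first.
  apply/setP => X; rewrite inE; apply/idP/andP => [XC|[XE sX]].
    split; first exact: (subsetP sC).
    by move: XC; rewrite eC !inE -orbA => /or3P[]/eqP ->; rewrite subUset !sub1set !inE !eqxx ?orbT.
  have /eqP/cards2P[x [y [xy eX]]] := card_edge XE.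
  by move: sX; rewrite eX subUset !sub1set => /andP[xC yC]; apply: eqE.
rewrite inE; apply/andP; split.
  by rewrite setUC cardsU1 cards2 uv !inE negb_or ![w == _]eq_sym uw vw.
apply/forall_inP => x xT; apply/forall_inP => y yT; apply/implyP => xy.
exact/(subsetP sC)/eqE.
Qed.

End SmallEven.

(** A graph whose cycle space has a generating family in which each edge is
    covered at most twice: MacLane's algebraic form of planarity.  The edges of
    the graph have their ends in [U]. *)
Section Sparse.
Variables (V I : finType) (U : {set V}) (Es : {set {set V}}).
Variable C : I -> {set {set V}}.
Hypothesis card_edge : forall X, X \in Es -> #|X| = 2.
Hypothesis edge_sub : forall X, X \in Es -> X \subset U.
Hypothesis U_neq0 : U != set0.
Hypothesis sub_C : forall i, C i \subset Es.
Hypothesis even_C : forall i, edge_even (C i).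
Hypothesis sparse_C : forall X, #|[set i | X \in C i]| <= 2.
Hypothesis span_C : forall Z : {set {set V}}, Z \subset Es -> edge_even Z ->
  exists S : I -> bool,
    forall X, X \in Es -> (X \in Z) = (\sum_i (S i && (X \in C i) : bool))%R.

Local Open Scope ring_scope.

(** The cycle space is the left kernel of the incidence matrix [A].  Every row
    of [A] sums to zero, so [A] has rank at most [#|U| - 1] and the cycle space
    has dimension at least [#|Es| - #|U| + 1].  The matrix [M] of the family [C]
    spans it; a maximal independent set of rows of [M] is the family wanted,
    since independent rows are distinct and nonzero. *)
Lemma sparse_rank : exists J : {set I},
  [/\ {in J &, injective C}, forall i, i \in J -> C i != set0 &
      (#|Es| + 1 <= #|J| + #|U|)%N].
Proof.
pose eU (j : 'I_#|U|) : V := enum_val j.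
pose eE (k : 'I_#|Es|) : {set V} := enum_val k.
pose A : 'M[bool]_(#|Es|, #|U|) := \matrix_(k, j) (eU j \in eE k : bool).
pose M : 'M[bool]_(#|I|, #|Es|) :=
  \matrix_(i, k) (eE k \in C (enum_val i) : bool).
have U0 : (0 < #|U|)%N by rewrite card_gt0.
have rA : (\rank A + 1 <= #|U|)%N.
  have A1 : A *m const_mx 1 = 0 :> 'M_(_, 1).
    apply/matrixP => k j; rewrite !mxE.
    under eq_bigr => l _ do rewrite !mxE mulr1.
    rewrite -(big_enum_val (A := [in U]) (fun v => (v \in enum_val k : bool))) /=.
    have kE : eE k \in Es := enum_valP k.
    have /eqP/cards2P[x [y [xy eX]]] := card_edge kE.
    have := edge_sub kE; rewrite eX subUset !sub1set => /andP[xU yU].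
    rewrite (bigD1 x) //= (bigD1 y) /=; last by rewrite yU eq_sym.
    rewrite -/(eE k) eX big1 ?addr0 ?set21 ?set22 // => z /andP[/andP[_ zx] zy].
    by rewrite !inE (negPf zx) (negPf zy).
  have := mulmx0_rank_max A1.
  suff -> : \rank (const_mx 1 : 'M[bool]_(#|U|, 1)) = 1%N by [].
  apply/eqP; rewrite eqn_leq rank_leq_col lt0n mxrank_eq0.
  apply/eqP => /matrixP/(_ (Ordinal U0) ord0); by rewrite !mxE.
have kM : (kermx A <= M)%MS.
  apply/row_subP => k; have : row k (kermx A) *m A = 0 by apply/sub_kermxP; apply: row_sub.
  move: (row k _) => z zA {k}.
  pose Z := [set X in Es | [exists l, (eE l == X) && z 0 l]].
  have ZE l : (eE l \in Z) = z 0 l.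
    rewrite inE enum_valP /=; apply/existsP/idP => [[m /andP[/eqP/enum_val_inj -> //]]|zl].
    by exists l; rewrite eqxx.
  have sZ : Z \subset Es by apply/subsetP => X; rewrite inE => /andP[].
  have evZ : edge_even Z.
    move=> v; rewrite (eq_bigl (fun X => (X \in Es) && (X \in Z))); last first.
      by move=> X; case: (boolP (X \in Z)) => [/(subsetP sZ) ->|]; rewrite ?andbF.
    rewrite big_mkcondr /=.
    have [vU|vU] := boolP (v \in U); last first.
      apply: big1 => X XE; case: ifP => // _.
      by apply: contraNF vU; apply/subsetP/edge_sub.
    rewrite (big_enum_val (A := [in Es]) (fun X => if X \in Z then (v \in X : bool) else 0)) /=.
    have /matrixP/(_ 0 (enum_rank_in vU v)) := zA.
    rewrite !mxE => E; rewrite -[RHS]E; apply: eq_bigr => l _.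
    have ev : eU (enum_rank_in vU v) = v by exact: enum_rankK_in.
    by rewrite !mxE ev -/(eE l) ZE; case: (z 0 l); rewrite ?mul1r ?mul0r.
  have [S HS] := span_C sZ evZ.
  apply/submxP; exists (\row_i (S (enum_val i))).
  apply/rowP => l; rewrite -ZE HS ?enum_valP // !mxE.
  rewrite (reindex (@enum_val I (mem I))) /=; last first.
    by exists enum_rank => x _; rewrite ?enum_valK ?enum_rankK.
  by apply: eq_bigr => i _; rewrite !mxE.
have rM : (#|Es| + 1 <= \rank M + #|U|)%N.
  have := mxrankS kM; rewrite mxrank_ker; lia.
pose f := maxrankfun M; have fr := maxrowsub_free M.
have f_inj : injective f by exact: maxrankfun_inj.
have rowM x : row x (rowsub f M) = \row_k (eE k \in C (enum_val (f x)) : bool).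
  by apply/rowP => k; rewrite !mxE.
have Mf0 x : row x (rowsub f M) != 0.
  rewrite rowE; apply/eqP => e0.
  have /(row_free_inj fr)/matrixP/(_ 0 x) :
    delta_mx 0 x *m rowsub f M = 0 *m rowsub f M :> 'rV_ _ by rewrite e0 mul0mx.
  by rewrite !mxE !eqxx.
have Cf : injective (fun x => C (enum_val (f x))).
  move=> x y exy; apply/eqP; have: row x (rowsub f M) = row y (rowsub f M).
    by rewrite !rowM; apply/rowP => k; rewrite !mxE exy.
  rewrite !rowE => /(row_free_inj fr)/matrixP/(_ 0 x).
  by rewrite !mxE !eqxx /=; case: eqVneq.
exists [set enum_val (f x) | x : 'I_(\rank M)]; split.
- by move=> i j /imsetP[x _ ->] /imsetP[y _ ->] /Cf ->.
- move=> i /imsetP[x _ ->]; apply: contra_neq (Mf0 x) => C0.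
  by rewrite rowM C0; apply/rowP => k; rewrite !mxE inE.
- rewrite card_imset ?card_ord //; exact: inj_comp enum_val_inj f_inj.
Qed.

(** Sum the sizes of the members of the independent family: at most [2 * #|Es|]
    because of sparseness, and at least four per member, except that those of
    size three are the edge sets of distinct triangles. *)
Lemma sparse_bound : (2 * #|Es| + 4 <= 4 * #|U| + #|triangle_in Es|)%N.
Proof.
have [J [injJ J0 cJ]] := sparse_rank.
have s2 : (\sum_(i in J) #|C i| <= 2 * #|Es|)%N.
  have -> : (\sum_(i in J) #|C i| = \sum_(X in Es) #|[set i in J | X \in C i]|)%N.
    transitivity (\sum_(i in J) \sum_(X in Es) (X \in C i))%N.
      apply: eq_bigr => i _; rewrite -sum1_card [RHS]big_mkcond [LHS]big_mkcond.
      apply: eq_bigr => X _; case: ifP => [/(subsetP (sub_C i)) -> //|_].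
      by case: ifP.
    rewrite exchange_big; apply: eq_bigr => X _.
    rewrite -sum1_card [LHS]big_mkcond [RHS]big_mkcond; apply: eq_bigr => i _.
    by rewrite inE; case: (i \in J); case: (X \in C i).
  rewrite mulnC -sum_nat_const; apply: leq_sum => X _.
  apply: leq_trans (sparse_C X); apply/subset_leq_card/subsetP => i.
  by rewrite !inE => /andP[].
pose J3 := [set i in J | #|C i| == 3].
have s4 : (4 * #|J| <= \sum_(i in J) #|C i| + #|J3|)%N.
  have -> : (#|J3| = \sum_(i in J) (#|C i| == 3))%N.
    rewrite -sum1_card big_mkcond [RHS]big_mkcond; apply: eq_bigr => i _.
    by rewrite inE; case: (i \in J); case: (_ == _).
  rewrite mulnC -sum_nat_const -big_split; apply: leq_sum => i iJ /=.
  have [|[u [v [w [uv vw uw eC]]]]] := even_small card_edge (sub_C i) (@even_C i) (J0 i iJ).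
    by move=> ?; apply: leq_trans (leq_addr _ _).
  by rewrite eC (card_triangle_edges uv vw uw).
have c3 : (#|J3| <= #|triangle_in Es|)%N.
  pose f i := cover (C i).
  have fC i : i \in J3 -> f i \in triangle_in Es /\ C i = [set X in Es | X \subset f i].
    rewrite inE => /andP[iJ /eqP Ci3].
    have [|[u [v [w [uv vw uw eC]]]]] := even_small card_edge (sub_C i) (@even_C i) (J0 i iJ).
      by rewrite Ci3.
    exact: (triangle_edges card_edge uv vw uw eC (sub_C i)).
  rewrite -(card_in_imset (f := f)); last first.
    move=> i j iJ jJ fij; have [_ ei] := fC _ iJ; have [_ ej] := fC _ jJ.
    move: iJ jJ; rewrite !inE => /andP[iJ _] /andP[jJ _].
    by apply: injJ => //; rewrite ei ej fij.
  by apply/subset_leq_card/subsetP => T /imsetP[i /fC[fi _] ->].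
lia.
Qed.
End Sparse.

(** * Faces of a minor of a cell complex *)

(** A finite cell complex with points [P], edges [L] and cells [Q].  The edge
    [i] runs from [s i] to [t i] and separates the cells [l i] and [r i]; a
    function [S] on cells has the jump [S (l i) + S (r i)] across [i].  The two
    hypotheses on the complex say that jumps add up to zero around each point,
    and that a cycle made of good edges bounds a set of cells.

    A graph on [V] with edge set [Es] is a minor of the complex: the points
    labelled [v] by [block] form a connected set that is contracted to [v], and
    the edge [X] of the graph is represented by the edge [link X] of the
    complex. *)
Section Minor.
Variables (P L Q : finType) (s t : L -> P) (l r : L -> Q) (good : pred L).
Local Open Scope ring_scope.

Definition boundary (c : L -> bool) (x : P) : bool :=
  \sum_i c i * ((s i == x) + (t i == x)).

Hypothesis jump_cycle : forall S : Q -> bool, forall x,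
  boundary (fun i => S (l i) + S (r i)) x = 0.
Hypothesis fill : forall z : L -> bool,
  (forall i, z i -> good i) -> (forall x, boundary z x = 0) ->
  exists S : Q -> bool, forall i, z i = S (l i) + S (r i).

Variables (V : finType) (block : P -> option V).

Definition inside (v : V) (i : L) :=
  [&& good i, block (s i) == Some v & block (t i) == Some v].

Definition step (v : V) : rel P := fun x y => [exists i, inside v i &&
  ((s i == x) && (t i == y) || (s i == y) && (t i == x))].

Hypothesis block_conn : forall v x y,
  block x = Some v -> block y = Some v -> connect (step v) x y.

Variables (Es : {set {set V}}) (link : {set V} -> L).
Hypothesis linkP : forall X, X \in Es -> good (link X) /\ exists u v,
  [/\ u != v, X = [set u; v], block (s (link X)) = Some u
    & block (t (link X)) = Some v].

Lemma boundaryD c d x : boundary (fun i => c i + d i) x = boundary c x + boundary d x.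
Proof. by rewrite /boundary -big_split; apply: eq_bigr => i _; rewrite mulrDl. Qed.

Lemma boundary1 j x : boundary (fun i => i == j) x = (s j == x) + (t j == x).
Proof.
rewrite /boundary (bigD1 j) //= eqxx mul1r big1 ?addr0 // => i /negPf ->.
by rewrite mul0r.
Qed.

Lemma bool_addrr (b : bool) : b + b = 0. Proof. by case: b. Qed.

(** The edges of a path, added modulo two, have the ends of the path as
    boundary, even when the path visits an edge several times. *)
Lemma path_chain v x y : connect (step v) x y ->
  exists c : L -> bool, (forall i, c i -> inside v i) /\
            (forall z, boundary c z = (x == z) + (y == z)).
Proof.
case/connectP => p; elim: p x => [|a p IH] x /=.
  move=> _ ->; exists (fun _ => 0); split=> // z.
  by rewrite bool_addrr /boundary big1 // => i _; rewrite mul0r.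
case/andP => /existsP[j /andP[vj ej]] pa yE.
have [c [cv cz]] := IH _ pa yE.
exists (fun i => (i == j) + c i); split=> [i|z].
  by have [->|_] := eqVneq i j; rewrite ?add0r => // /cv.
rewrite boundaryD boundary1 cz; case/orP: ej => /andP[/eqP-> /eqP->];
  by case: (x == z); case: (a == z); case: (y == z).
Qed.

(** A reference point in each block.  The option type leaves room for vertices
    with an empty block, which are isolated. *)
Definition anchor (v : V) : option P := [pick x | block x == Some v].

Lemma anchor_chain v x : block x = Some v ->
  exists c : L -> bool, (forall i, c i -> inside v i) /\
            (forall z, boundary c z = (x == z) + (anchor v == Some z)).
Proof.
move=> bx; rewrite /anchor; case: pickP => [y /eqP by_|/(_ x)]; last by rewrite bx eqxx.
by apply: path_chain; apply: block_conn.
Qed.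

Lemma link_not_inside X v : X \in Es -> inside v (link X) = false.
Proof.
move=> /linkP[_ [a [b [ab _ ba bb]]]]; apply/negP => /and3P[_].
by rewrite ba bb => /eqP[eav] /eqP[ebv]; rewrite eav ebv eqxx in ab.
Qed.

(** An edge [X] of the graph lifts to a chain of the complex that goes from the
    anchor of one end of [X] through its block to [link X], crosses over, and
    reaches the other anchor.  The boundaries of these chains depend only on the
    ends of [X], so that the lifts of the edges of a cycle add up to a cycle. *)
Lemma edge_chain X : X \in Es -> exists c : L -> bool,
  [/\ forall i, c i -> good i,
      forall i, c i -> i = link X \/ exists v, inside v i,
      c (link X)
    & forall x, boundary c x = \sum_v (v \in X) * (anchor v == Some x)].
Proof.
move=> XE; have [gX [u [v [uv eX bu bv]]]] := linkP XE.
have [c [cu cz]] := anchor_chain bu; have [d [dv dz]] := anchor_chain bv.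
have nin w := link_not_inside w XE.
exists (fun i => (i == link X) + (c i + d i)); split.
- move=> i; have [->//|_] := eqVneq i (link X).
  rewrite add0r; case E : (c i); first by case/cu/and3P: E.
  by rewrite add0r => /dv/and3P[].
- move=> i; have [->|_] := eqVneq i (link X); first by left.
  rewrite add0r; case E : (c i); first by move: E => /cu; right; exists u.
  by rewrite add0r => /dv; right; exists v.
- rewrite eqxx; case E : (c _); first by move/cu: E; rewrite nin.
  by case E' : (d _); first by move/dv: E'; rewrite nin.
move=> x; rewrite !boundaryD boundary1 cz dz.
rewrite (bigD1 u) //= (bigD1 v) /=; last by rewrite eq_sym.
rewrite eX set21 set22 big1 ?mul1r => [|w /andP[/negPf wu /negPf wv]]; last first.
  by rewrite !inE wu wv mul0r.
by rewrite addr0 addrACA addrACA; case: (_ == x); case: (_ == x); case: (_ == _); case: (_ == _).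
Qed.

Lemma link_inj : {in Es &, injective link}.
Proof.
move=> X Y /linkP[_ [u [v [_ -> bu bv]]]] /linkP[_ [a [b [_ -> ba bb]]]] e.
by move: bu bv; rewrite e ba bb => -[->] [->].
Qed.

(** The edges of the complex that survive in the drawing of the graph.  Two
    cells separated by any other edge lie in the same face. *)
Definition kept (i : L) := (i \in link @: Es) || [exists v, inside v i].

Definition leak : rel Q := fun p q => [exists i, ~~ kept i &&
  ((l i == p) && (r i == q) || (l i == q) && (r i == p))].

Lemma leak_sym : connect_sym leak.
Proof.
apply: sym_connect_sym => p q; apply: eq_existsb => i.
by rewrite orbC.
Qed.

Definition face := fingraph.root leak.

Lemma face_leak i : ~~ kept i -> face (l i) = face (r i).
Proof.
move=> ki; apply/(fingraph.rootP leak_sym)/connect1/existsP; exists i.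
by rewrite ki !eqxx.
Qed.

Lemma const_face (S : Q -> bool) : (forall i, ~~ kept i -> S (l i) = S (r i)) ->
  forall p, S (face p) = S p.
Proof.
move=> h p; have := connect_root leak p; rewrite -/(face p).
case/connectP => q; elim: q p (face p) => [|a q IH] p f /=; first by move=> _ ->.
case/andP => /existsP[i /andP[/h Si e]] /IH{}IH /IH ->.
by case/orP: e => /andP[/eqP <- /eqP <-].
Qed.

Definition face_edges (F : Q) : {set {set V}} :=
  [set X in Es | (face (l (link X)) == F) + (face (r (link X)) == F) : bool].

(** Let [J] be the jump of the indicator of the face [F].  Its boundary vanishes
    at each point by [jump_cycle]; now sum over the block of [v].  Edges inside
    the block are met twice, edges leaving it that are not kept have zero jump,
    and what remains are the links of the edges at [v]. *)
Lemma face_edges_even F : edge_even (face_edges F).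
Proof.
move=> v; pose f p := (face p == F : bool).
pose J i := f (l i) + f (r i).
pose b x := (block x == Some v : bool).
have e0 : \sum_x b x * boundary J x = 0.
  by apply: big1 => x _; rewrite (jump_cycle f) mulr0.
have e1 : \sum_x b x * boundary J x = \sum_i J i * (b (s i) + b (t i)).
  under eq_bigr => x _ do rewrite mulr_sumr.
  rewrite exchange_big; apply: eq_bigr => i _.
  under eq_bigr => x _ do rewrite mulrCA.
  rewrite -mulr_sumr; congr (_ * _).
  under eq_bigr => x _ do rewrite mulrDr.
  rewrite big_split; congr (_ + _).
    rewrite (bigD1 (s i)) //= eqxx mulr1 big1 ?addr0 // => x.
    by rewrite eq_sym => /negPf ->; rewrite mulr0.
  rewrite (bigD1 (t i)) //= eqxx mulr1 big1 ?addr0 // => x.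
  by rewrite eq_sym => /negPf ->; rewrite mulr0.
rewrite -[RHS]e0 e1 (bigID [in link @: Es]) /= [X in _ = _ + X]big1 ?addr0.
  rewrite big_imset /=; last exact: link_inj.
  rewrite (eq_bigl (fun X => (X \in Es) && (X \in face_edges F))); last first.
    by move=> X; rewrite inE; case: (X \in Es).
  rewrite big_mkcondr /=; apply: eq_bigr => X XE.
  rewrite inE XE /= -/(f _) -/(f _) -/(J _).
  have [_ [x [y [xy eX bx by_]]]] := linkP XE.
  have -> : (v \in X : bool) = b (s (link X)) + b (t (link X)).
    rewrite /b bx by_ eX !inE !(inj_eq (@Some_inj _)) ![v == _]eq_sym.
    have [xv|_] := eqVneq x v; last by rewrite add0r.
    by rewrite -xv eq_sym (negPf xy).
  by case: (J _); rewrite ?mul1r ?mul0r.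
move=> i iE; have [/existsP[w /and3P[_ /eqP bs /eqP bt]]|ni] := boolP [exists v, inside v i].
  by rewrite /b bs bt bool_addrr mulr0.
have ki : ~~ kept i by rewrite /kept negb_or iE.
by rewrite /J /f (face_leak ki) bool_addrr mul0r.
Qed.

Lemma face_edges_sparse X : (#|[set F | X \in face_edges F]| <= 2)%N.
Proof.
apply: leq_trans (_ : #|[set face (l (link X)); face (r (link X))]| <= 2)%N.
  apply/subset_leq_card/subsetP => F; rewrite !inE => /andP[_].
  by rewrite ![F == _]eq_sym; case: (_ == _); case: (_ == _).
by rewrite cards2; case: (_ != _).
Qed.

(** An even edge set lifts to a cycle of the complex, which bounds a set [S] of
    cells.  The lift contains only kept edges, so [S] is a union of faces, and
    restricting to the links expresses the edge set as the sum of the boundaries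
    of these faces. *)
Lemma face_edges_span (Z : {set {set V}}) : Z \subset Es -> edge_even Z ->
  exists S : Q -> bool, forall X, X \in Es ->
    (X \in Z) = \sum_F (S F && (X \in face_edges F) : bool).
Proof.
move=> /subsetP sZ evZ.
have /choice[cc ccP] : forall X, exists c : L -> bool, X \in Es ->
  [/\ forall i, c i -> good i,
      forall i, c i -> i = link X \/ exists v, inside v i,
      c (link X)
    & forall x, boundary c x = \sum_v (v \in X) * (anchor v == Some x)].
  move=> X; case: (boolP (X \in Es)) => [/edge_chain[c]|_]; first by exists c.
  by exists xpred0.
pose z i := \sum_(X in Z) cc X i.
have z1 i : z i -> exists2 X, X \in Z & cc X i.
  have [X /andP[]|no] := pickP [pred X | (X \in Z) && cc X i]; first by exists X.
  by rewrite /z big1 // => X XZ; have := no X; rewrite /= XZ.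
have [|x|S HS] := fill (z := z).
- by move=> i /z1[X /sZ/ccP[h _ _ _]]; apply: h.
- rewrite /boundary; under eq_bigr => i _ do rewrite /z mulr_suml.
  rewrite exchange_big /=.
  transitivity (\sum_(X in Z) \sum_v (v \in X) * (anchor v == Some x : bool)).
    by apply: eq_bigr => X /sZ/ccP[_ _ _ <-].
  rewrite exchange_big big1 // => v _.
  by rewrite -mulr_suml evZ mul0r.
have zlam X : X \in Es -> z (link X) = (X \in Z).
  move=> XE; rewrite /z (eq_bigl (fun Y => (Y \in Es) && (Y \in Z))); last first.
    by move=> Y; case: (boolP (Y \in Z)) => [/sZ ->|]; rewrite ?andbF.
  rewrite big_mkcondr (bigD1 X) //= big1 ?addr0.
    by case: ifP => // _; case/ccP: XE.
  move=> Y /andP[YE YX]; case: ifP => // _; apply/negP => /= cY.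
  have [_ h _ _] := ccP _ YE; case: (h _ cY) => [/link_inj|[v]].
    by move=> /(_ XE YE) XY; rewrite XY eqxx in YX.
  by rewrite link_not_inside.
have zk i : ~~ kept i -> S (l i) = S (r i).
  move=> ki; have : z i = 0.
    case zi : (z i) => //; have [X /sZ XE ci] := z1 i zi.
    have [_ h _ _] := ccP _ XE.
    have /negP[] := ki; rewrite /kept.
    case: (h _ ci) => [->|[v vi]]; first by rewrite imset_f.
    by apply/orP; right; apply/existsP; exists v.
  by rewrite HS; case: (S _); case: (S _).
exists S => X XE; rewrite -zlam // HS -(const_face zk (l _)) -(const_face zk (r _)).
transitivity (\sum_F (S F * (face (l (link X)) == F) + S F * (face (r (link X)) == F))).
  have h G : \sum_F S F * (G == F) = S G.
    rewrite (bigD1 G) //= eqxx mulr1 big1 ?addr0 // => F.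
    by rewrite eq_sym => /negPf ->; rewrite mulr0.
  by rewrite big_split /= !h.
apply: eq_bigr => F _; rewrite inE XE /=.
by case: (S F); rewrite ?mul1r ?mul0r.
Qed.

Lemma minor_bound (U : {set V}) : U != set0 ->
  (forall X, X \in Es -> X \subset U) ->
  (2 * #|Es| + 4 <= 4 * #|U| + #|triangle_in Es|)%N.
Proof.
move=> U0 sU; apply: (@sparse_bound _ Q U Es face_edges) => //.
- by move=> X /linkP[_ [u [v [uv -> _ _]]]]; rewrite cards2 uv.
- by move=> F; apply/subsetP => X; rewrite inE => /andP[].
- exact: face_edges_even.
- exact: face_edges_sparse.
- exact: face_edges_span.
Qed.

End Minor.

(** * The toroidal square grid *)

(** On a torus no point of the grid is special, so that coordinates may be added
    freely and [torus_cycle] holds everywhere.  Cycles are required to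
    stay in the square with coordinates from 1 to [n], away from the seam, which
    makes them bound as they would in the plane.  A cell has the name of the
    corner from which both coordinates increase inside the cell; the direction
    [true] is the second coordinate. *)
Section Torus.
Variable n : nat.
Local Notation T := ('I_n.+2 * 'I_n.+2)%type.
Local Open Scope ring_scope.

Definition tdir (b : bool) : T := if b then (0, 1) else (1, 0).
Definition tsrc (i : bool * T) : T := i.2.
Definition ttgt (i : bool * T) : T := i.2 + tdir i.1.
Definition tleft (i : bool * T) : T := i.2.
Definition tright (i : bool * T) : T := i.2 - tdir (~~ i.1).

Definition tinner (x : T) : bool :=
  [&& 0 < x.1, x.1 <= n, 0 < x.2 & x.2 <= n]%N.
Definition tgood (i : bool * T) : bool := tinner (tsrc i) && tinner (ttgt i).

Lemma torus_boundary (z : bool * T -> bool) x : boundary tsrc ttgt z x =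
  z (false, x) + z (true, x) + (z (false, x - (1, 0)) + z (true, x - (0, 1))).
Proof.
have pick1 (f : bool * T -> T) (g : bool -> T) :
    (forall b y, (f (b, y) == x) = (y == g b)) ->
    \sum_i z i * (f i == x) = z (false, g false) + z (true, g true).
  move=> fg; transitivity (\sum_b \sum_y z (b, y) * (f (b, y) == x)).
    by rewrite pair_bigA; apply: eq_bigr => -[].
  rewrite big_bool /= addrC.
  have h b : \sum_y z (b, y) * (f (b, y) == x) = z (b, g b).
    rewrite (bigD1 (g b)) //= fg eqxx mulr1 big1 ?addr0 // => y /negPf yg.
    by rewrite fg yg mulr0.
  by rewrite !h.
rewrite /boundary; under eq_bigr => i _ do rewrite mulrDr.
rewrite big_split /= (pick1 tsrc (fun=> x)) // (pick1 ttgt (fun b => x - tdir b)) //.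
by move=> b y; rewrite /ttgt /= (can2_eq (addrK _) (subrK _)).
Qed.

Lemma torus_cycle (S : T -> bool) x :
  boundary tsrc ttgt (fun i => S (tleft i) + S (tright i)) x = 0.
Proof.
rewrite torus_boundary /tleft /tright /=.
rewrite -!addrA -[- (1, 0) - _]opprD -[- (0, 1) - _]opprD [(0, 1) + _]addrC.
by case: (S x); case: (S _); case: (S _); case: (S _).
Qed.

Local Notation o k := (inord k : 'I_n.+2).

Lemma inord_pred k : (k < n.+1)%N -> o k.+1 - 1 = o k.
Proof.
move=> kn; apply/eqP; rewrite subr_eq; apply/eqP/val_inj => /=.
rewrite !inordK //; last by apply: leq_trans kn _.
by rewrite [(1 %% _)%N]modn_small // addn1 modn_small.
Qed.

(** Whether a cell lies inside the cycle [z] is read off by counting modulo two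
    the edges of [z] that a ray towards the first column crosses.  For edges in
    the direction of the ray, the jump is computed by induction along two
    neighbouring rays, using that [z] has no boundary. *)
Lemma torus_fill (z : bool * T -> bool) :
  (forall i, z i -> tgood i) -> (forall x, boundary tsrc ttgt z x = 0) ->
  exists S : T -> bool, forall i, z i = S (tleft i) + S (tright i).
Proof.
move=> zg zb.
have z0 i : ~~ tinner (tsrc i) -> z i = 0.
  move=> ni; case E: (z i) => //.
  by move/zg: E; rewrite /tgood (negPf ni).
have z0f j : z (false, (o 0, j)) = 0 by rewrite z0 // /tinner /= inordK.
have z0t j : z (true, (o 0, j)) = 0 by rewrite z0 // /tinner /= inordK.
have zmf j : z (false, (o n.+1, j)) = 0.
  by rewrite z0 // /tinner /= inordK // ltnn andbF.
pose S (x : T) : bool := \sum_(k < n.+2 | (k <= x.1)%N) z (true, (k, x.2)).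
have S0 j : S (o 0, j) = 0.
  rewrite /S big1 //= => k; rewrite inordK // leqn0 => /eqP k0.
  by have -> : k = o 0; [apply: val_inj; rewrite /= inordK | exact: z0t].
have Sk k j : (k < n.+1)%N -> S (o k.+1, j) = z (true, (o k.+1, j)) + S (o k, j).
  move=> kn; have kn' : (k < n.+2)%N by apply: leq_trans kn _.
  rewrite /S (bigD1 (o k.+1)) //=; congr (_ + _); apply: eq_bigl => i.
  by rewrite !inordK // -(inj_eq val_inj) /= inordK // andbC -ltn_neqAle.
have H k j : (k < n.+2)%N -> z (false, (o k, j)) = S (o k, j) + S (o k, j - 1).
  elim: k => [|k IH] kn; first by rewrite z0f !S0.
  have := zb (o k.+1, j); rewrite torus_boundary !Sk //.
  have -> : (o k.+1, j) - (1, 0) = (o k, j) by congr (_, _); rewrite /= ?inord_pred ?subr0.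
  have -> : (o k.+1, j) - (0, 1) = (o k.+1, j - 1) by congr (_, _); rewrite /= ?subr0.
  rewrite IH ?(ltnW kn) //.
  by case: (z _); case: (z _); case: (z _); case: (S _); case: (S _).
have last0 k : (k < n.+2)%N -> S (o n.+1, o k) = 0.
  elim: k => [_|k IH kn].
    by rewrite /S big1 // => i _; rewrite z0 // /tinner /= inordK // !andbF.
  have := H n.+1 (o k.+1) (ltnSn _); rewrite zmf inord_pred // IH ?(ltnW kn) //.
  by case: (S _).
exists S => -[[] [i j]]; rewrite /tleft /tright /=.
  rewrite -(inord_val i); case: (i : nat) (ltn_ord i) => [_|k kn].
    rewrite z0t S0.
    have -> : (o 0, j) - (1, 0) = (o n.+1, o j).
      congr (_, _); rewrite /= ?subr0 ?inord_val //.
      apply/eqP; rewrite subr_eq; apply/eqP/val_inj; rewrite /= !inordK //.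
      by rewrite [(1 %% _)%N]modn_small // addn1 modnn.
    by rewrite last0.
  have -> : (o k.+1, j) - (1, 0) = (o k, j) by congr (_, _); rewrite /= ?inord_pred ?subr0.
  by rewrite Sk //; case: (z _); case: (S _).
have -> : (i, j) - (0, 1) = (i, j - 1) by congr (_, _); rewrite /= ?subr0.
by rewrite -(inord_val i) H.
Qed.

End Torus.

(** * From lattice walks to a grid minor *)

Definition edges (V : finType) (e : rel V) : {set {set V}} :=
  [set X | [exists u, exists v, e u v && (X == [set u; v])]].

Lemma edgesP (V : finType) (e : rel V) X :
  reflect (exists u v, e u v /\ X = [set u; v]) (X \in edges e).
Proof.
rewrite inE; apply: (iffP existsP) => [[u /existsP[v /andP[uv /eqP ->]]]|[u [v [uv ->]]]].
  by exists u, v.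
by exists u; apply/existsP; exists v; rewrite uv eqxx.
Qed.

(** A drawing on the grid in which each edge is a walk of [3 * k] steps, that
    may stand still or revisit points.  Walks of different edges may meet near a
    common end, but the first thirds of walks that start at different vertices
    are disjoint, and the middle third of a walk avoids the walks of all other
    edges.  This is what survives when a drawing by disjoint arcs is rounded to
    a fine grid. *)
Section Walks.
Variables (n : nat) (V : finType) (e : rel V).
Local Notation T := ('I_n.+2 * 'I_n.+2)%type.
Hypothesis e_sym : symmetric e.
Hypothesis e_irr : irreflexive e.
Variables (k : nat) (W : V -> V -> nat -> T).

Definition linked (x y : T) : Prop := exists i : bool * T,
  tgood i /\ ((tsrc i = x /\ ttgt i = y) \/ (tsrc i = y /\ ttgt i = x)).

Hypothesis walk_step : forall u v j, e u v -> j < 3 * k ->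
  W u v j = W u v j.+1 \/ linked (W u v j) (W u v j.+1).
Hypothesis walk_rev : forall u v j, e u v -> j <= 3 * k ->
  W v u j = W u v (3 * k - j).
Hypothesis walk_start : forall u v w, e u v -> e u w -> W u v 0 = W u w 0.
Hypothesis starts_apart : forall u v x y i j, e u x -> e v y -> u != v ->
  i <= k -> j <= k -> W u x i != W v y j.
Hypothesis middles_apart : forall u v x y i j, e u x -> e v y ->
  [set u; x] != [set v; y] -> k <= i <= 2 * k -> j <= 3 * k -> W u x i != W v y j.

Definition core v (x : T) : bool :=
  [exists w, exists j : 'I_k.+1, e v w && (W v w j == x)].

Lemma coreP v x :
  reflect (exists w j, [/\ j <= k, e v w & x = W v w j]) (core v x).
Proof.
apply: (iffP existsP) => [[w /existsP[j /andP[vw /eqP <-]]]|[w [j [jk vw ->]]]].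
  by exists w, j; split=> //; rewrite -ltnS.
by exists w; apply/existsP; exists (inord j); rewrite vw inordK ?eqxx.
Qed.

(** The core of a vertex is the union of the first thirds of its walks.  The
    walk from [u] to [v] enters the core of [v] at time [2 * k] at the latest, and
    up to that entry its points can be contracted to [u] without touching the core
    of [v]. *)
Definition entry u v := find (fun j => core v (W u v j)) (iota 0 (2 * k).+1).

Lemma entry_le u v : e u v -> entry u v <= 2 * k.
Proof.
move=> uv; rewrite -ltnS -[X in _ < X](size_iota 0) -has_find.
apply/hasP; exists (2 * k); first by rewrite mem_iota ltnSn.
apply/coreP; exists u, k; split=> //; first by rewrite e_sym.
rewrite (walk_rev (u := v)) ?(e_sym v) //; last lia.
by congr (W v u _); lia.
Qed.

Lemma entry_core u v : e u v -> core v (W u v (entry u v)).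
Proof.
move=> uv; have le := entry_le uv.
have := nth_find 0 (a := fun j => core v (W u v j)) (s := iota 0 (2 * k).+1).
by rewrite has_find size_iota -/(entry u v) ltnS nth_iota ?ltnS // add0n; apply.
Qed.

Lemma before_entry u v j : e u v -> j < entry u v -> ~~ core v (W u v j).
Proof.
move=> uv lt; have := before_find 0 lt; have := entry_le uv.
by move=> le; rewrite nth_iota ?add0n => [->|] //; lia.
Qed.

Lemma entry_gt u v : e u v -> k < entry u v.
Proof.
move=> uv; rewrite ltnNge; apply/negP => le.
have /coreP[w [j [jk vw E]]] := entry_core uv.
have nuv : u != v by apply: contraTneq uv => ->; rewrite e_irr.
by have := starts_apart uv vw nuv le jk; rewrite E eqxx.
Qed.

(** To contract each edge only once, the part of the walk between the two cores
    goes to the end of smaller rank. *)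
Definition owns v (x : T) : Prop := core v x \/ exists w j,
  [/\ e v w, enum_rank v < enum_rank w, k < j < entry v w & x = W v w j].

(** Cores are disjoint since first thirds are.  A point owned by [v] beyond its
    core is in the middle third of a walk towards some [w], which meets the core
    of no third vertex; it lies before the entry into the core of [w]; and it
    meets no other middle third. *)
Lemma owns_inj u v x : owns u x -> owns v x -> u = v.
Proof.
move=> ux vx; apply/eqP; apply/idPn => uv.
have cc a b : a != b -> core a x -> ~ core b x.
  move=> ab /coreP[w [i [ik aw ->]]] /coreP[y [j [jk by_ /eqP]]].
  exact/negP/starts_apart.
have cm a b : a != b -> core a x -> ~ (exists w j,
  [/\ e b w, enum_rank b < enum_rank w, k < j < entry b w & x = W b w j]).
  move=> ab ax [w [j [bw _ /andP[kj jE] xE]]].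
  have /coreP[y [i [ik ay xE']]] := ax.
  have [eab|ne] := eqVneq [set b; w] [set a; y].
    have wa : w = a.
      have : a \in [set b; w] by rewrite eab set21.
      by rewrite !inE (negPf ab) => /eqP.
    by have := before_entry bw jE; rewrite -xE wa ax.
  have := middles_apart (i := j) (j := i) bw ay ne.
  have := entry_le bw; rewrite -xE -xE' eqxx => le.
  by move=> h; have: ~~ true by apply: h; lia.
case: ux => [ux|ux]; case: vx => [vx|vx].
- exact: cc ux vx.
- exact: cm ux vx.
- by apply: (cm v u) => //; rewrite eq_sym.
case: ux vx => [w [i [uw ruw /andP[ki iE] ->]]] [y [j [vy rvy /andP[kj jE]]]].
have ne : [set u; w] != [set v; y].
  apply/eqP => E; have : v \in [set u; w] by rewrite E set21.
  rewrite !inE eq_sym (negPf uv) => /eqP vw.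
  have : u \in [set v; y] by rewrite -E set21.
  rewrite !inE (negPf uv) => /eqP uy.
  by move: ruw rvy; rewrite vw uy; lia.
have := entry_le uw; have := entry_le vy => h1 h2.
by apply/eqP/middles_apart => //; lia.
Qed.

Definition block x : option V := [pick v | `[< owns v x >]].

Lemma blockP x v : (block x = Some v) <-> owns v x.
Proof.
rewrite /block; case: pickP => [w /asboolP wx|no].
  by split=> [[<-]|vx] //; congr Some; apply: owns_inj wx vx.
by split=> // vx; have /asboolP := no v.
Qed.

Definition tstep := step (@tsrc n) (@ttgt n) (@tgood n) block.

Lemma tstep_sym v : symmetric (tstep v).
Proof. by move=> x y; apply: eq_existsb => i; rewrite orbC. Qed.

Lemma linked_step v x y : owns v x -> owns v y -> linked x y -> tstep v x y.
Proof.
move=> /blockP bx /blockP by_ [i [gi h]]; apply/existsP; exists i.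
by case: h => -[sx tx]; rewrite /inside gi sx tx bx by_ !eqxx ?orbT.
Qed.

Lemma owned_walk v x : owns v x -> exists w j, [/\ e v w, j <= 3 * k, x = W v w j
   & forall i, i <= j -> owns v (W v w i)].
Proof.
case=> [/coreP[w [j [jk vw ->]]]|[w [j [vw rvw /andP[kj jE] ->]]]].
  exists w, j; split=> //; first lia.
  by move=> i ij; left; apply/coreP; exists w, i; split=> //; lia.
exists w, j; split=> //; first by have := entry_le vw; lia.
move=> i ij; have [ik|ki] := leqP i k; first by left; apply/coreP; exists w, i.
by right; exists w, i; split=> //; lia.
Qed.

Lemma walk_connect v w j : e v w -> j <= 3 * k ->
  (forall i, i <= j -> owns v (W v w i)) -> connect (tstep v) (W v w 0) (W v w j).
Proof.
move=> vw; elim: j => [|j IH] jk ow; first exact: connect0.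
apply: connect_trans (IH _ _) _; [lia | by move=> i ij; apply: ow; lia |].
case: (walk_step (u := v) (v := w) (j := j)) => // [->|]; first exact: connect0.
by move=> lk; apply: connect1; apply: linked_step => //; apply: ow.
Qed.

Lemma block_connect v x y :
  block x = Some v -> block y = Some v -> connect (tstep v) x y.
Proof.
move=> /blockP/owned_walk[w [i [vw ik -> wi]]] /blockP/owned_walk[z [j [vz jk -> zj]]].
apply: (connect_trans (y := W v w 0)).
  rewrite (sym_connect_sym (@tstep_sym v)); exact: walk_connect.
by rewrite (walk_start vw vz); apply: walk_connect.
Qed.

(** The last step before the entry leads from the block of [u] into the core of
    [v]; it is a genuine grid edge because the blocks are disjoint. *)
Lemma edge_link X : X \in edges e -> exists i : bool * T, tgood i /\ exists u v,
  [/\ u != v, X = [set u; v], block (tsrc i) = Some u & block (ttgt i) = Some v].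
Proof.
case/edgesP => u [v [uv ->]].
wlog ruv : u v uv / enum_rank u < enum_rank v.
  move=> H; case: (ltngtP (enum_rank u) (enum_rank v)) => [|lt|/val_inj/enum_rank_inj E].
  - exact: H.
  - by rewrite setUC; apply: H; rewrite 1?e_sym.
  - by move: uv; rewrite E e_irr.
have nuv : u != v by apply: contraTneq uv => ->; rewrite e_irr.
have gt := entry_gt uv; have le := entry_le uv.
have [r rE] : exists r, entry u v = r.+1 by exists (entry u v).-1; lia.
have cr := entry_core uv; rewrite rE in cr gt le.
have ou : owns u (W u v r).
  have [rk|kr] := leqP r k; first by left; apply/coreP; exists v, r.
  right; exists v, r; split=> //.
  by rewrite kr rE ltnSn.
have ov : owns v (W u v r.+1) by left.
have r3 : r < 3 * k by lia.
have [E|[i [gi h]]] := walk_step uv r3.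
  by move: nuv; rewrite -E in ov; rewrite (owns_inj ou ov) eqxx.
exists i; split=> //; move/blockP: ou => ou; move/blockP: ov => ov.
case: h => -[-> ->]; [by exists u, v | exists v, u].
by rewrite eq_sym setUC.
Qed.

Lemma walks_bound (U : {set V}) : U != set0 -> (forall u v, e u v -> u \in U) ->
  2 * #|edges e| + 4 <= 4 * #|U| + #|triangle_in (edges e)|.
Proof.
move=> U0 eU.
have /choice[link linkP] : forall X, exists i : bool * T, X \in edges e ->
    tgood i /\ exists u v, [/\ u != v, X = [set u; v],
      block (tsrc i) = Some u & block (ttgt i) = Some v].
  move=> X; have [/edge_link[i Hi]|_] := boolP (X \in edges e); first by exists i.
  by exists (false, (ord0, ord0)).
apply: (minor_bound (@torus_cycle n) (@torus_fill n) block_connect linkP U0).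
move=> X /edgesP[u [v [uv ->]]]; rewrite subUset !sub1set (eU u v) //.
by rewrite (eU v u) // e_sym.
Qed.

End Walks.

(** * Compactness of families of arcs *)

Section Uniform.
Variable R : realType.
Local Open Scope classical_set_scope.
Local Open Scope ring_scope.

Lemma ball_prodE (z w : R * R) (e : R) :
  ball z e w <-> `|z.1 - w.1| < e /\ `|z.2 - w.2| < e.
Proof. by split => -[]. Qed.

(** The existence of a Lebesgue number, for an arbitrary local property with a
    scale [d]. *)
Lemma segment_uniform (a b : R) (P : R -> R -> Prop) :
  (forall x, x \in `[a, b] -> exists2 r, 0 < r & forall y d,
     y \in `[a, b] -> `|x - y| < r -> 0 < d < r -> P d y) ->
  exists2 d, 0 < d & forall y, y \in `[a, b] -> P d y.
Proof.
move=> loc.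
have /compact_near_coveringP cov := @segment_compact R a b.
have := cov R (0^'+)%R (fun d y => y \in `[a, b] -> P d y) _.
case.
  move=> x /= xab; have [r r0 H] := loc x xab.
  exists (ball x r, [set d : R | 0 < d < r]) => /=; last first.
    by move=> [y d] /= [xy dr] yab; apply: H.
  split; first exact: nbhsx_ballx.
  by near=> d; apply/andP; split; near: d;
    [exact: nbhs_right_gt | exact: nbhs_right_lt].
move=> r /= r0 H; exists (r / 2); first by rewrite divr_gt0.
move=> y yab; apply: (H (r / 2)) => //=.
  by rewrite sub0r normrN gtr0_norm ?divr_gt0 // ltr_pdivrMr // ltr_pMr // ltr1n.
by rewrite divr_gt0.
Unshelve. all: by end_near. Qed.

Lemma finite_uniform (I : finType) (P : R -> I -> Prop) :
  (forall i, exists2 r, 0 < r & forall d, 0 < d < r -> P d i) ->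
  exists2 r, 0 < r & forall d i, 0 < d < r -> P d i.
Proof.
move=> H; suff [r r0 Hr] : exists2 r : R, 0 < r &
    forall d i, i \in enum I -> 0 < d < r -> P d i.
  by exists r => // d i; apply: Hr; rewrite mem_enum.
elim: (enum I) => [|i s [r r0 Hr]]; first by exists 1.
have [r' r'0 Hr'] := H i; exists (Num.min r r'); first by rewrite lt_min r0.
move=> d j; rewrite inE lt_min => /orP[/eqP ->|js] /and3P[d0 dr dr'].
  by apply: Hr'; rewrite d0.
by apply: Hr => //; rewrite d0.
Qed.

(** Continuity on the unit interval in terms of radii, which reversal of the
    parameter visibly preserves. *)
Definition curve_cont (g : R -> R * R) : Prop := forall x d,
  x \in `[0, 1] -> 0 < d -> exists2 r, 0 < r &
    forall y, y \in `[0, 1] -> `|x - y| < r -> ball (g x) d (g y).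

Lemma within_curve_cont (g : R -> R * R) : {within `[0, 1], continuous g} -> curve_cont g.
Proof.
move=> gc x d x01 d0; have /subspace_continuousP/(_ x x01)/cvg_ballP/(_ d d0) := gc.
rewrite near_withinE => /nbhs_ballP[r /= r0 H].
by exists r => // y y01 xy; apply: H.
Qed.

Lemma curve_cont_rev (g : R -> R * R) : curve_cont g -> curve_cont (fun t => g (1 - t)).
Proof.
have rev (x : R) : x \in `[0, 1] -> 1 - x \in `[0, 1] by rewrite !in_itv /=; lra.
move=> gc x d /rev x01 d0; have [r r0 H] := gc _ d x01 d0.
exists r => // y /rev y01 xy; apply: H => //.
by rewrite (_ : 1 - x - (1 - y) = - (x - y)) ?normrN //; lra.
Qed.

Section Curve.
Variable g : R -> R * R.
Hypothesis curve_local : curve_cont g.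

Lemma curve_uniform d : 0 < d -> exists2 r, 0 < r & forall x y,
  x \in `[0, 1] -> y \in `[0, 1] -> `|x - y| < r -> ball (g x) d (g y).
Proof.
move=> d0; have [|r r0 H] := @segment_uniform 0 1 (fun r x =>
  forall y, y \in `[0, 1] -> `|x - y| < r -> ball (g x) d (g y)).
  move=> x x01; have d2 : 0 < d / 2 by lra.
  have [r r0 H] := curve_local x01 d2; exists (r / 2); first lra.
  move=> y e y01 xy /andP[_ er] z z01 yz.
  rewrite [d]splitr; apply: (@ball_triangle _ _ (g x)).
    by apply/ball_sym/H => //; lra.
  by apply: H => //; have := ler_distD y x z; lra.
by exists r => // x y x01 y01; apply: H.
Qed.

(** The bound is given as the inverse of a small number, so that
    [finite_uniform] makes it common to finitely many curves. *)
Lemma curve_bounded : exists2 r, 0 < r & forall d, 0 < d < r ->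
  forall x, x \in `[0, 1] -> `|(g x).1| < d^-1 /\ `|(g x).2| < d^-1.
Proof.
have [|r r0 H] := @segment_uniform 0 1 (fun d x =>
    `|(g x).1| < d^-1 /\ `|(g x).2| < d^-1).
  move=> x x01; have [r r0 H] := curve_local x01 ltr01.
  pose B := `|(g x).1| + `|(g x).2| + 1.
  have B0 : 0 < B by rewrite /B; have := normr_ge0 (g x).1; have := normr_ge0 (g x).2; lra.
  exists (Num.min r B^-1); first by rewrite lt_min r0 invr_gt0.
  move=> y d y01; rewrite !lt_min => /andP[xy _] /and3P[d0 _ dB].
  have BD : B < d^-1 by rewrite -[B]invrK ltf_pV2 // posrE invr_gt0.
  have /ball_prodE[h1 h2] := H y y01 xy.
  have := normr_ge0 (g x).1; have := normr_ge0 (g x).2.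
  have := lerB_dist (g y).1 (g x).1; have := lerB_dist (g y).2 (g x).2.
  move: BD h1 h2; rewrite /B [`|(g y).1 - _|]distrC [`|(g y).2 - _|]distrC; lra.
exists r => // d /andP[d0 dr] x /H[h1 h2].
have : r^-1 < d^-1 by rewrite ltf_pV2 // posrE.
by move: h1 h2; lra.
Qed.

End Curve.

Lemma point_away (h : R -> R * R) (c d : R) p :
  curve_cont h -> {subset `[c, d] <= `[0, 1]} ->
  (forall t, t \in `[c, d] -> p != h t) ->
  exists2 r, 0 < r & forall t, t \in `[c, d] -> ~ ball p r (h t).
Proof.
move=> hc cd ne; apply: segment_uniform => t tcd.
have [m m0 Hm] : exists2 m : R, 0 < m & ~ ball p (m + m) (h t).
  have := ne t tcd; rewrite -pair_eqE negb_and => /orP[] /= e.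
    exists (`|p.1 - (h t).1| / 2); first by rewrite divr_gt0 // normr_gt0 subr_eq0.
    by rewrite -splitr => /ball_prodE[]; rewrite ltxx.
  exists (`|p.2 - (h t).2| / 2); first by rewrite divr_gt0 // normr_gt0 subr_eq0.
  by rewrite -splitr => /ball_prodE[_]; rewrite ltxx.
have [r r0 H] := hc _ _ (cd _ tcd) m0.
exists (Num.min r m); first by rewrite lt_min r0.
move=> y e yab; rewrite !lt_min => /andP[ty _] /and3P[e0 _ em] py.
apply: Hm; apply: (@ball_triangle _ _ (h y)).
  exact: le_ball (ltW em) _ py.
by apply/ball_sym/H => //; apply: cd.
Qed.

Lemma curves_away (g h : R -> R * R) (a b c d : R) :
  curve_cont g -> curve_cont h ->
  {subset `[a, b] <= `[0, 1]} -> {subset `[c, d] <= `[0, 1]} ->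
  (forall s t, s \in `[a, b] -> t \in `[c, d] -> g s != h t) ->
  exists2 r, 0 < r & forall e, 0 < e < r ->
    forall s t, s \in `[a, b] -> t \in `[c, d] -> ~ ball (g s) e (h t).
Proof.
move=> gc hc ab cd ne.
have [|r r0 H] := @segment_uniform a b (fun r s =>
    forall t, t \in `[c, d] -> ~ ball (g s) r (h t)).
  move=> s sab.
  have [|m m0 Hm] := @point_away h c d (g s) hc cd; first by move=> t; apply: ne.
  have m2 : 0 < m / 2 by lra.
  have [r r0 H] := gc _ _ (ab _ sab) m2.
  exists (Num.min r (m / 2)); first by rewrite lt_min r0.
  move=> y e yab; rewrite !lt_min => /andP[sy _] /and3P[e0 _ em] t tcd yt.
  apply: (Hm t tcd); rewrite [m]splitr; apply: (@ball_triangle _ _ (g y)).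
    by apply: H => //; apply: ab.
  exact: le_ball (ltW em) _ yt.
exists r => // e /andP[e0 er] s t sab tcd st.
by apply: (H s sab t tcd); apply: le_ball (ltW er) _ st.
Qed.

End Uniform.

(** * Rounding points of the plane to the grid *)

Section Lattice.
Variable n : nat.
Definition lattice_pt (a b : nat) : 'I_n.+2 * 'I_n.+2 := (inord a, inord b).

Lemma lattice_pt_inj a b a' b' : a <= n -> b <= n -> a' <= n -> b' <= n ->
  lattice_pt a b = lattice_pt a' b' -> a = a' /\ b = b'.
Proof.
move=> ha hb ha' hb' [/(congr1 val) + /(congr1 val)].
by rewrite /= !inordK //; lia.
Qed.

Lemma lattice_pt_inner a b : 0 < a <= n -> 0 < b <= n -> tinner (lattice_pt a b).
Proof. by move=> ha hb; rewrite /tinner /= !inordK; lia. Qed.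

Lemma linked_sym (x y : 'I_n.+2 * 'I_n.+2) : linked x y -> linked y x.
Proof. by case=> i [gi [h|h]]; exists i; split=> //; [right|left]. Qed.

Lemma inord_succ a : a <= n -> (inord a + 1 = inord a.+1 :> 'I_n.+2)%R.
Proof. by move=> an; rewrite -(@inord_pred n a) ?subrK. Qed.

Lemma lattice_pt_right a b : 0 < a < n -> 0 < b <= n -> linked (lattice_pt a b) (lattice_pt a.+1 b).
Proof.
move=> ha hb; exists (false, lattice_pt a b).
have E : ttgt (false, lattice_pt a b) = lattice_pt a.+1 b.
  rewrite /ttgt /=; congr (_, _); rewrite /= ?addr0 // inord_succ //; lia.
by rewrite /tgood E /tsrc /= !lattice_pt_inner; [split; [|left]|lia..].
Qed.

Lemma lattice_pt_up a b : 0 < a <= n -> 0 < b < n -> linked (lattice_pt a b) (lattice_pt a b.+1).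
Proof.
move=> ha hb; exists (true, lattice_pt a b).
have E : ttgt (true, lattice_pt a b) = lattice_pt a b.+1.
  rewrite /ttgt /=; congr (_, _); rewrite /= ?addr0 // inord_succ //; lia.
by rewrite /tgood E /tsrc /= !lattice_pt_inner; [split; [|left]|lia..].
Qed.

Lemma lattice_pt_row a a' b : 0 < a <= n -> 0 < a' <= n -> 0 < b <= n ->
  a <= a'.+1 -> a' <= a.+1 -> lattice_pt a b = lattice_pt a' b \/
    linked (lattice_pt a b) (lattice_pt a' b).
Proof.
move=> ha ha' hb h h'; have [E|[->|E]] : a = a'.+1 \/ a = a' \/ a' = a.+1 by lia.
- by right; rewrite E; apply/linked_sym/lattice_pt_right => //; lia.
- by left.
- by right; rewrite E; apply: lattice_pt_right => //; lia.
Qed.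

Lemma lattice_pt_col a b b' : 0 < a <= n -> 0 < b <= n -> 0 < b' <= n ->
  b <= b'.+1 -> b' <= b.+1 -> lattice_pt a b = lattice_pt a b' \/
    linked (lattice_pt a b) (lattice_pt a b').
Proof.
move=> ha hb hb' h h'; have [E|[->|E]] : b = b'.+1 \/ b = b' \/ b' = b.+1 by lia.
- by right; rewrite E; apply/linked_sym/lattice_pt_up => //; lia.
- by left.
- by right; rewrite E; apply: lattice_pt_up => //; lia.
Qed.
End Lattice.

Section Cell.
Variables (R : realType) (M d : R).
Local Open Scope ring_scope.
Hypothesis d0 : 0 < d.

(** The rounding of a coordinate to a grid of mesh [d], for coordinates smaller
    than [M] in absolute value.  Shifting by [M] makes the truncated number
    positive, and adding 1 keeps the result away from the seam of the torus. *)
Definition cell (c : R) : nat := (Num.truncn ((c + M) / d)).+1.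

Lemma cell_itv c : `|c| < M ->
  (cell c).-1%:R * d <= c + M < (cell c)%:R * d.
Proof.
rewrite ltr_norml => /andP[cM _].
have h : 0 <= (c + M) / d by rewrite divr_ge0 ?(ltW d0) //; lra.
have /andP[] := Num.Theory.truncn_itv h.
by rewrite ler_pdivlMr // ltr_pdivrMr // => -> ->.
Qed.

Lemma cell_le c : `|c| < M -> (cell c <= (Num.truncn ((M + M) / d)).+1)%N.
Proof.
rewrite ltr_norml => /andP[cM Mc]; rewrite ltnS; apply: Num.Theory.le_truncn.
by rewrite ler_pM2r ?invr_gt0 //; lra.
Qed.

Lemma cell_eq c c' : `|c| < M -> `|c'| < M -> cell c = cell c' -> `|c - c'| < d.
Proof.
move=> /cell_itv h /cell_itv h' E; rewrite -E in h'.
have e1 : (cell c)%:R = (cell c).-1%:R + 1 :> R by rewrite -natr1.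
move: h h'; rewrite e1 mulrDl mul1r ltr_norml; lra.
Qed.

Lemma cell_close c c' : `|c| < M -> `|c'| < M -> `|c - c'| < d ->
  (cell c <= (cell c').+1)%N.
Proof.
move=> /cell_itv/andP[h _] /cell_itv/andP[_ h']; rewrite ltr_norml => /andP[_ cc].
have e : (cell c).-1%:R * d < (cell c').+1%:R * d.
  by rewrite -natr1 mulrDl mul1r; lra.
by move: e; rewrite ltr_pM2r // ltr_nat.
Qed.

End Cell.

(** * From a drawing by arcs to lattice walks *)

(** A drawing of the graph by arcs parametrized by the unit interval, with
    opposite parametrizations for the two directions of an edge. *)
Section Drawing.
Variables (R : realType) (V : finType) (e : rel V).
Local Open Scope classical_set_scope.
Local Open Scope ring_scope.
Hypothesis e_sym : symmetric e.
Hypothesis e_irr : irreflexive e.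
Variables (pt : V -> R * R) (curve : V -> V -> R -> R * R).
Hypothesis curve_cts : forall u v, e u v -> curve_cont (curve u v).
Hypothesis curve_rev : forall u v t, e u v -> curve v u t = curve u v (1 - t).
Hypothesis curve_inj : forall u v, e u v -> {in `[0, 1] &, injective (curve u v)}.
Hypothesis curve0 : forall u v, e u v -> curve u v 0 = pt u.
Hypothesis curve_vertex : forall u v w t, e u v -> t \in `[0, 1] ->
  curve u v t = pt w -> w = u \/ w = v.
Hypothesis curve_meet : forall u v x y s t, e u x -> e v y ->
  [set u; x]%SET != [set v; y]%SET -> s \in `[0, 1] -> t \in `[0, 1] ->
  curve u x s = curve v y t -> exists w, curve u x s = pt w.

Lemma curve1 u v : e u v -> curve u v 1 = pt v.
Proof.
by move=> uv; rewrite curve_rev ?subrr ?curve0 // e_sym.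
Qed.

Lemma curve_at_vertex u v w t : e u v -> t \in `[0, 1] -> curve u v t = pt w ->
  (w = u /\ t = 0) \/ (w = v /\ t = 1).
Proof.
move=> uv t01 E; have [wE|wE] := curve_vertex uv t01 E; [left|right]; split=> //.
  apply: (curve_inj uv) => //; last by rewrite curve0 // E wE.
  by rewrite in_itv /= lexx ler01.
apply: (curve_inj uv) => //; last by rewrite curve1 // E wE.
by rewrite in_itv /= lexx ler01.
Qed.

Lemma third_sub : {subset `[0, 3^-1] <= `[0, 1 : R]}.
Proof. by move=> t; rewrite !in_itv /=; lra. Qed.

Lemma middle_sub : {subset `[3^-1, 2 * 3^-1] <= `[0, 1 : R]}.
Proof. by move=> t; rewrite !in_itv /=; lra. Qed.

Lemma first_thirds_neq u v x y s t : e u x -> e v y -> u != v ->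
  s \in `[0, 3^-1] -> t \in `[0, 3^-1] -> curve u x s != curve v y t.
Proof.
move=> ux vy uv s3 t3; apply/eqP => E.
have [se|sn] := eqVneq [set u; x]%SET [set v; y]%SET.
  have yu : y = u.
    by have := set21 u x; rewrite se !inE (negPf uv) /= => /eqP.
  have xv : x = v.
    by have := set21 v y; rewrite -se !inE [v == u]eq_sym (negPf uv) /= => /eqP.
  subst x y; move: E; rewrite (curve_rev t ux) => E.
  move: s3 t3; rewrite !in_itv /= => s3 t3.
  have : s = 1 - t by apply: (curve_inj ux) E; rewrite in_itv /=; lra.
  by lra.
have [w Ew] := curve_meet ux vy sn (third_sub s3) (third_sub t3) E.
have [[wu _]|[_ s1]] := curve_at_vertex ux (third_sub s3) Ew; last first.
  by move: s3; rewrite s1 in_itv /=; lra.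
rewrite E in Ew.
have [[wv _]|[_ t1]] := curve_at_vertex vy (third_sub t3) Ew; last first.
  by move: t3; rewrite t1 in_itv /=; lra.
by move: uv; rewrite -wu -wv eqxx.
Qed.

Lemma middle_neq u v x y s t : e u x -> e v y ->
  [set u; x]%SET != [set v; y]%SET ->
  s \in `[3^-1, 2 * 3^-1] -> t \in `[0, 1] -> curve u x s != curve v y t.
Proof.
move=> ux vy ne s3 t1; apply/eqP => E.
have [w Ew] := curve_meet ux vy ne (middle_sub s3) t1 E.
by have [[_ s0]|[_ s0]] := curve_at_vertex ux (middle_sub s3) Ew;
  move: s3; rewrite s0 in_itv /=; lra.
Qed.

(** One distance separates all pairs of compact pieces of arcs that are required
    to be disjoint: the initial thirds of arcs that start at different vertices, and
    the middle third of an arc from the whole of any other arc. *)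
Lemma curves_separated : exists2 d : R, 0 < d &
  (forall u v x y s t, e u x -> e v y -> u != v ->
    s \in `[0, 3^-1] -> t \in `[0, 3^-1] -> ~ ball (curve u x s) d (curve v y t)) /\
  (forall u v x y s t, e u x -> e v y -> [set u; x]%SET != [set v; y]%SET ->
    s \in `[3^-1, 2 * 3^-1] -> t \in `[0, 1] -> ~ ball (curve u x s) d (curve v y t)).
Proof.
have [|d1 d10 H1] := @finite_uniform R (V * V * (V * V))%type (fun d i =>
    forall s t, e i.1.1 i.1.2 -> e i.2.1 i.2.2 -> i.1.1 != i.2.1 ->
    s \in `[0, 3^-1] -> t \in `[0, 3^-1] ->
    ~ ball (curve i.1.1 i.1.2 s) d (curve i.2.1 i.2.2 t)).
  move=> [[u x] [v y]] /=.
  have [ux|nux] := boolP (e u x); last by exists 1.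
  have [vy|nvy] := boolP (e v y); last by exists 1.
  have [uv|nuv] := eqVneq u v; first by exists 1.
  have [|r r0 H] := curves_away (curve_cts ux) (curve_cts vy) third_sub third_sub.
  - by move=> s t; apply: first_thirds_neq.
  - by exists r => // d dr s t _ _ _; apply: H.
have [|d2 d20 H2] := @finite_uniform R (V * V * (V * V))%type (fun d i =>
    forall s t, e i.1.1 i.1.2 -> e i.2.1 i.2.2 ->
    [set i.1.1; i.1.2]%SET != [set i.2.1; i.2.2]%SET ->
    s \in `[3^-1, 2 * 3^-1] -> t \in `[0, 1] ->
    ~ ball (curve i.1.1 i.1.2 s) d (curve i.2.1 i.2.2 t)).
  move=> [[u x] [v y]] /=.
  have [ux|nux] := boolP (e u x); last by exists 1.
  have [vy|nvy] := boolP (e v y); last by exists 1.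
  have [uv|nuv] := eqVneq [set u; x]%SET [set v; y]%SET; first by exists 1.
  have [||r r0 H] := @curves_away R _ _ 3^-1 (2 * 3^-1) 0 1
    (curve_cts ux) (curve_cts vy) middle_sub.
  - by [].
  - by move=> s t; apply: middle_neq.
  - by exists r => // d dr s t _ _ _; apply: H.
pose m := Num.min d1 d2; have m0 : 0 < m by rewrite lt_min d10.
have m1 : m <= d1 by rewrite ge_min lexx.
have m2 : m <= d2 by rewrite ge_min lexx orbT.
exists (m / 2); first lra.
have h1 : 0 < m / 2 < d1 by lra.
have h2 : 0 < m / 2 < d2 by lra.
split=> u v x y s t; first exact: (H1 _ (u, x, (v, y)) h1).
exact: (H2 _ (u, x, (v, y)) h2).
Qed.

Lemma curves_uniform d : 0 < d -> exists2 r, 0 < r & forall u v s t, e u v ->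
  s \in `[0, 1] -> t \in `[0, 1] -> `|s - t| < r -> ball (curve u v s) d (curve u v t).
Proof.
move=> d0; have [|r r0 H] := @finite_uniform R (V * V)%type (fun r i =>
    forall s t, e i.1 i.2 -> s \in `[0, 1] -> t \in `[0, 1] -> `|s - t| < r ->
    ball (curve i.1 i.2 s) d (curve i.1 i.2 t)).
  move=> [u v] /=; have [uv|_] := boolP (e u v); last by exists 1.
  have [r r0 H] := curve_uniform (curve_cts uv) d0; exists r => // r' r'r s t _ s1 t1 st.
  by apply: H => //; lra.
exists (r / 2); first lra.
by move=> u v s t uv; apply: (H (r / 2) (u, v)) => //; lra.
Qed.

Lemma curves_bounded : exists M : R, forall u v s, e u v -> s \in `[0, 1] ->
  `|(curve u v s).1| < M /\ `|(curve u v s).2| < M.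
Proof.
have [|r r0 H] := @finite_uniform R (V * V)%type (fun r i =>
    forall s, e i.1 i.2 -> s \in `[0, 1] ->
    `|(curve i.1 i.2 s).1| < r^-1 /\ `|(curve i.1 i.2 s).2| < r^-1).
  move=> [u v] /=; have [uv|_] := boolP (e u v); last by exists 1.
  have [r r0 H] := curve_bounded (curve_cts uv); exists r => // d dr s _.
  exact: H.
exists (r / 2)^-1 => u v s uv s1.
by apply: (H (r / 2) (u, v)) => //=; lra.
Qed.

(** The arcs are sampled so finely that consecutive samples are closer than the
    mesh [d] of the grid, and rounding moves points by about [d].  With [3 * d]
    at most the distance of [curves_separated], the rounded walks inherit the
    disjointness of the arcs. *)
Section Sampling.
Variables (d r M : R) (N : nat).
Hypothesis d0 : 0 < d.
Hypothesis curve_near : forall u v s t, e u v -> s \in `[0, 1] -> t \in `[0, 1] ->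
  `|s - t| < r -> ball (curve u v s) d (curve u v t).
Hypothesis curve_bnd : forall u v s, e u v -> s \in `[0, 1] ->
  `|(curve u v s).1| < M /\ `|(curve u v s).2| < M.
Hypothesis N_gt : (3 * N)%:R^-1 < r.
Hypothesis N0 : (0 < N)%N.

Let k := (2 * N)%N.
Let n := (Num.truncn ((M + M) / d)).+1.
Let c := cell M d.

Definition sample (i : nat) : R := i%:R / (3 * N)%:R.
Definition time (j : nat) : R := j%:R / (3 * k)%:R.

Let N3 : 0 < (3 * N)%:R :> R. Proof. by rewrite ltr0n muln_gt0 N0. Qed.
Let K3 : 0 < (3 * k)%:R :> R. Proof. by rewrite ltr0n /k !muln_gt0 N0. Qed.

Lemma sample01 i : (i <= 3 * N)%N -> sample i \in `[0, 1].
Proof.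
by move=> iN; rewrite in_itv /= divr_ge0 ?ler0n // ler_pdivrMr // mul1r ler_nat.
Qed.

Lemma time01 j : (j <= 3 * k)%N -> time j \in `[0, 1].
Proof.
by move=> jk; rewrite in_itv /= divr_ge0 ?ler0n // ler_pdivrMr // mul1r ler_nat.
Qed.

Lemma sample_time i : sample i = time (2 * i).
Proof.
rewrite /sample /time /k mulnCA ![(2 * _)%:R]natrM -mulf_div.
by rewrite divff ?mul1r // pnatr_eq0.
Qed.

Lemma time_close i j : (i <= j.+2)%N -> (j <= i.+2)%N -> `|time i - time j| < r.
Proof.
move=> ij ji; apply: le_lt_trans N_gt.
rewrite -mulrBl normrM [X in _ * X]gtr0_norm ?invr_gt0 //.
rewrite ler_pdivrMr // /k mulnCA (natrM _ 2) mulrCA mulVf ?mulr1 ?lt0r_neq0 //.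
move: ij ji; rewrite -!(ler_nat R) -!natr1 ler_norml; lra.
Qed.

(** Rounding consecutive samples can change both coordinates at once, which is not
    a grid step.  So the walk updates the two coordinates in turn: at time [j] the
    first one comes from the sample [uphalf j] and the second from the sample
    [j./2]. *)
Definition base_walk u v j : 'I_n.+2 * 'I_n.+2 :=
  lattice_pt n (c (curve u v (sample (uphalf j))).1) (c (curve u v (sample j./2)).2).

(** The alternation in [base_walk] is not symmetric under reversal; an edge is
    therefore always traversed from its end of smaller rank. *)
Definition walk u v j := if (enum_rank u < enum_rank v)%N then base_walk u v j
  else base_walk v u (3 * k - j).

Lemma cell_bnd u v s : e u v -> s \in `[0, 1] ->
  (0 < c (curve u v s).1 <= n)%N /\ (0 < c (curve u v s).2 <= n)%N.
Proof. by move=> uv s1; have [h1 h2] := curve_bnd uv s1; split; apply: cell_le. Qed.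

Lemma half_le j : (j <= 3 * k)%N -> (uphalf j <= 3 * N)%N /\ (j./2 <= 3 * N)%N.
Proof. rewrite /k; lia. Qed.

Lemma walk_near u v j : e u v -> (j <= 3 * k)%N -> exists a b : R,
  [/\ walk u v j = lattice_pt n (c a) (c b), `|a| < M /\ `|b| < M &
      ball (curve u v (time j)) d (a, b)].
Proof.
move=> uv jk.
have base x y i : e x y -> (i <= 3 * k)%N -> exists a b : R,
    [/\ base_walk x y i = lattice_pt n (c a) (c b), `|a| < M /\ `|b| < M &
      ball (curve x y (time i)) d (a, b)].
  move=> xy ik; have [h1 h2] := half_le ik.
  exists (curve x y (sample (uphalf i))).1, (curve x y (sample i./2)).2; split=> //.
    by split; [case: (curve_bnd xy (sample01 h1))|case: (curve_bnd xy (sample01 h2))].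
  apply/ball_prodE; split=> /=.
    have t : `|time i - sample (uphalf i)| < r.
      by rewrite sample_time; apply: time_close; lia.
    by have /ball_prodE[] := curve_near xy (time01 ik) (sample01 h1) t.
  have t : `|time i - sample (i./2)| < r.
    by rewrite sample_time; apply: time_close; lia.
  by have /ball_prodE[] := curve_near xy (time01 ik) (sample01 h2) t.
rewrite /walk; case: ifP => _; first exact: base.
rewrite e_sym in uv; rewrite curve_rev //.
have -> : 1 - time j = time (3 * k - j).
  by rewrite /time natrB // mulrBl divff // lt0r_neq0.
by apply: base => //; lia.
Qed.

Lemma walk_apart u v x y i j : e u x -> e v y -> (i <= 3 * k)%N -> (j <= 3 * k)%N ->
  ~ ball (curve u x (time i)) (3 * d) (curve v y (time j)) ->
  walk u x i != walk v y j.
Proof.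
move=> ux vy ik jk nb; apply/eqP => E; apply: nb.
have [a [b [Ea [aM bM] /ball_prodE[/= a1 b1]]]] := walk_near ux ik.
have [a' [b' [Eb [aM' bM'] /ball_prodE[/= a2 b2]]]] := walk_near vy jk.
move: E; rewrite Ea Eb => /lattice_pt_inj[]; try exact: cell_le.
move=> /(cell_eq d0 aM aM') ha /(cell_eq d0 bM bM') hb.
apply/ball_prodE; move: a1 b1 a2 b2 ha hb; rewrite !ltr_norml; lra.
Qed.

Lemma base_step u v j : e u v -> (j < 3 * k)%N ->
  base_walk u v j = base_walk u v j.+1 \/ linked (base_walk u v j) (base_walk u v j.+1).
Proof.
move=> uv jk; have [h1 h2] := half_le (ltnW jk); have [h3 h4] := half_le jk.
have [b1 b2] := cell_bnd uv (sample01 h1); have [b3 b4] := cell_bnd uv (sample01 h2).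
have [b5 b6] := cell_bnd uv (sample01 h3); have [b7 b8] := cell_bnd uv (sample01 h4).
have near_cells i i' : (i <= 3 * N)%N -> (i' <= 3 * N)%N ->
    (i <= i'.+1)%N -> (i' <= i.+1)%N ->
    (c (curve u v (sample i)).1 <= (c (curve u v (sample i')).1).+1)%N /\
    (c (curve u v (sample i)).2 <= (c (curve u v (sample i')).2).+1)%N.
  move=> iN iN' ii' i'i.
  have [m1 m2] := curve_bnd uv (sample01 iN); have [m1' m2'] := curve_bnd uv (sample01 iN').
  have t : `|sample i - sample i'| < r.
    by rewrite !sample_time; apply: time_close; lia.
  have /ball_prodE[p1 p2] := curve_near uv (sample01 iN) (sample01 iN') t.
  by split; apply: cell_close.
have [jo|je] := boolP (odd j).
  have eq1 : uphalf j.+1 = uphalf j by lia.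
  rewrite /base_walk eq1; have [_ n1] := near_cells (j./2) (j.+1./2) h2 h4 ltac:(lia) ltac:(lia).
  have [_ n2] := near_cells (j.+1./2) (j./2) h4 h2 ltac:(lia) ltac:(lia).
  exact: lattice_pt_col.
have eq1 : (j.+1)./2 = j./2 by lia.
rewrite /base_walk eq1; have [n1 _] := near_cells (uphalf j) (uphalf j.+1) h1 h3
  ltac:(lia) ltac:(lia).
have [n2 _] := near_cells (uphalf j.+1) (uphalf j) h3 h1 ltac:(lia) ltac:(lia).
exact: lattice_pt_row.
Qed.

Lemma walk_steps u v j : e u v -> (j < 3 * k)%N ->
  walk u v j = walk u v j.+1 \/ linked (walk u v j) (walk u v j.+1).
Proof.
move=> uv jk; rewrite /walk; case: ifP => _; first exact: base_step.
have -> : (3 * k - j = (3 * k - j.+1).+1)%N by lia.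
have vu : e v u by rewrite e_sym.
have lt : (3 * k - j.+1 < 3 * k)%N by lia.
have [->|lk] := base_step vu lt; first by left.
by right; apply: linked_sym.
Qed.

Lemma walk_reverse u v j : e u v -> (j <= 3 * k)%N -> walk v u j = walk u v (3 * k - j).
Proof.
move=> uv jk; rewrite /walk; case: (ltngtP (enum_rank u) (enum_rank v)) => //.
  by rewrite subKn.
by move=> /val_inj/enum_rank_inj E; rewrite E e_irr in uv.
Qed.

Lemma walk0 u v : e u v -> walk u v 0 = lattice_pt n (c (pt u).1) (c (pt u).2).
Proof.
move=> uv; rewrite /walk; case: ifP => _.
  by rewrite /base_walk /sample /= mul0r curve0.
have E : (3 * k = (3 * N).*2)%N by rewrite /k; lia.
rewrite subn0 E /base_walk uphalf_double half_double /sample divff ?lt0r_neq0 //.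
by rewrite curve1 // e_sym.
Qed.

End Sampling.

Lemma drawing_bound (U : {set V}) : U != finset.set0 -> (forall u v, e u v -> u \in U) ->
  (2 * #|edges e| + 4 <= 4 * #|U| + #|triangle_in (edges e)|)%N.
Proof.
move=> U0 eU.
have [d d0 [sep1 sep2]] := curves_separated.
have d3 : 0 < d / 3 by lra.
have [r r0 unif] := curves_uniform d3.
have [M bnd] := curves_bounded.
have [N N0 N_gt] : exists2 N : nat, (0 < N)%N & (3 * N)%:R^-1 < r.
  exists (Num.truncn r^-1).+1 => //.
  have ri : 0 <= r^-1 by rewrite invr_ge0 ltW.
  have /andP[_ h] := Num.Theory.truncn_itv ri.
  rewrite -[r]invrK ltf_pV2 ?posrE ?invr_gt0 ?ltr0n //; apply: lt_le_trans h _.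
  by rewrite invrK ler_nat leq_pmull.
have third (j : nat) : (j <= 2 * N)%N -> time N j \in `[0, 3^-1].
  move=> jN; rewrite in_itv /= divr_ge0 ?ler0n //= ler_pdivrMr ?ltr0n; last lia.
  by rewrite natrM mulKf ?pnatr_eq0 // ler_nat.
have middle (j : nat) : (2 * N <= j <= 2 * (2 * N))%N -> time N j \in `[3^-1, 2 * 3^-1].
  move=> /andP[Nj jN]; rewrite in_itv /= ler_pdivrMr ?ler_pdivlMr ?ltr0n; [|lia..].
  by rewrite natrM -mulrA !mulKf ?pnatr_eq0 // -natrM !ler_nat Nj.
have dE : 3 * (d / 3) = d by lra.
apply: (walks_bound e_sym e_irr (k := (2 * N)%N) (W := walk (d / 3) M N)) => //.
- by move=> u v j uv jk; apply: (walk_steps d3 unif bnd N_gt).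
- by move=> u v j uv jk; apply: walk_reverse.
- by move=> u v w uv uw; rewrite !(walk0 M d3 N_gt).
- move=> u v x y i j ux vy uv ik jk.
  have [i3 j3] : (i <= 3 * (2 * N) /\ j <= 3 * (2 * N))%N by lia.
  apply: (walk_apart d3 unif bnd N_gt) => //.
  by rewrite dE; apply: sep1 => //; apply: third.
- move=> u v x y i j ux vy uv ik jk.
  have i3 : (i <= 3 * (2 * N))%N by lia.
  apply: (walk_apart d3 unif bnd N_gt) => //.
  by rewrite dE; apply: sep2 => //; [apply: middle | apply: time01].
Qed.

End Drawing.

Section Planar.
Variables (R : realType) (V : finType).
Local Open Scope classical_set_scope.
Local Open Scope ring_scope.

Lemma planar_sub (e h : rel V) : subrel h e -> planar R e -> planar R h.
Proof.
move=> he [pt [arc [pi ap av am]]]; exists pt, arc; split=> //.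
- by move=> u v /he; apply: ap.
- by move=> u v w /he; apply: av.
- by move=> u v x y z /he uv /he; apply: am.
Qed.

(** A substitute for Euler's formula, which gives this inequality by counting
    edges along faces when every face is bounded by at least four edges, except
    for at most one face per triangle.  Here the faces are those of a grid minor
    obtained from the drawing. *)
Lemma planar_bound (e : rel V) (U : {set V}) :
  symmetric e -> irreflexive e -> planar R e -> U != finset.set0 ->
  (forall u v, e u v -> u \in U) ->
  (2 * #|edges e| + 4 <= 4 * #|U| + #|triangle_in (edges e)|)%N.
Proof.
move=> e_sym e_irr [pt [arc [_ arcP arc_vertex arc_meet]]] U0 eU.
have /choice[g gP] : forall p : V * V, exists g : R -> R * R, e p.1 p.2 ->
    [/\ curve_cont g, {in `[0, 1] &, injective g}, g 0 = pt p.1, g 1 = pt p.2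
      & forall t, t \in `[0, 1] -> arc [set p.1; p.2]%SET (g t)].
  move=> [u v] /=; have [uv|_] := boolP (e u v); last by exists (fun _ => 0).
  have [g [gc gi g0 g1 ga]] := arcP u v uv; exists g => _; split=> //.
    exact: within_curve_cont.
  by move=> t t01; rewrite ga; exists t.
pose curve u v t := if (enum_rank u < enum_rank v)%N then g (u, v) t else g (v, u) (1 - t).
have curveP u v : e u v -> [/\ curve_cont (curve u v),
    {in `[0, 1] &, injective (curve u v)}, curve u v 0 = pt u
    & forall t, t \in `[0, 1] -> arc [set u; v]%SET (curve u v t)].
  have rev (x : R) : x \in `[0, 1] -> 1 - x \in `[0, 1] by rewrite !in_itv /=; lra.
  move=> uv; rewrite /curve; case: ifP => _; first by case: (gP (u, v)).
  rewrite e_sym in uv; have [gc gi g0 g1 ga] := gP (v, u) uv; split.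
  - exact: curve_cont_rev.
  - by move=> x y /rev x1 /rev y1 /(gi _ _ x1 y1); lra.
  - by rewrite subr0.
  - by move=> t /rev /ga; rewrite finset.setUC.
apply: (@drawing_bound R V e e_sym e_irr pt curve) => //.
- by move=> u v /curveP[].
- move=> u v t uv; rewrite /curve; case: (ltngtP (enum_rank u) (enum_rank v)) => //.
    by rewrite subKr.
  by move=> /val_inj/enum_rank_inj E; rewrite E e_irr in uv.
- by move=> u v /curveP[].
- by move=> u v /curveP[].
- move=> u v w t uv t01 E; apply: (arc_vertex u v w uv).
  by rewrite -E; case: (curveP u v uv) => _ _ _; apply.
- move=> u v x y s t ux vy ne s01 t01 E.
  apply: (arc_meet u x v y _ ux vy ne); first by case: (curveP u x ux) => _ _ _; apply.
  by rewrite E; case: (curveP v y vy) => _ _ _; apply.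
Qed.

End Planar.

(** * Counting edges and triangles in kite-free graphs *)

Lemma edges_pair (V : finType) (h : rel V) x y : symmetric h ->
  ([set x; y] \in edges h) = h x y.
Proof.
move=> h_sym; apply/edgesP/idP => [[u [v [uv E]]]|xy]; last by exists x, y.
have := set21 x y; have := set22 x y; have := set21 u v; have := set22 u v.
rewrite -{1 2}E {3 4}E !inE.
case/orP=> /eqP h1; case/orP=> /eqP h2; case/orP=> /eqP h3; case/orP=> /eqP h4;
  by subst; rewrite // h_sym.
Qed.

Section Counting.
Variables (V : finType) (e : rel V).
Hypothesis e_sym : symmetric e.
Hypothesis e_irr : irreflexive e.

Lemma edgesE x y : ([set x; y] \in edges e) = e x y.
Proof. exact: edges_pair. Qed.

Lemma edge_card X : X \in edges e -> #|X| = 2.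
Proof.
case/edgesP => u [v [uv ->]]; rewrite cards2; case: eqVneq => // E.
by rewrite E e_irr in uv.
Qed.

Lemma exchange_count (S : {set {set V}}) (B : {set V}) :
  \sum_(v in B) #|[set X in S | v \in X]| = \sum_(X in S) #|X :&: B|.
Proof.
transitivity (\sum_(v in B) \sum_(X in S) (v \in X)).
  apply: eq_bigr => v _; rewrite -sum1_card big_mkcond [RHS]big_mkcond.
  by apply: eq_bigr => X _; rewrite inE; case: (X \in S); case: (v \in X).
rewrite exchange_big; apply: eq_bigr => X _.
rewrite -sum1_card big_mkcond [RHS]big_mkcond.
by apply: eq_bigr => v _; rewrite inE; case: (v \in B); case: (v \in X).
Qed.

Lemma degree_edges v : degree e v = #|[set X in edges e | v \in X]|.
Proof.
rewrite /degree -(card_in_imset (f := fun w => [set v; w])); last first.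
  by move=> w w' _ _; apply: set2_eqr.
congr #|pred_of_set _|; apply/setP => X; rewrite inE.
apply/imsetP/andP => [[w]|[XE vX]].
  by rewrite inE => vw ->; rewrite edgesE vw set21.
have [w wv E] := other_end edge_card XE vX.
by exists w => //; rewrite inE -edgesE -E.
Qed.

Lemma handshake : \sum_v degree e v = 2 * #|edges e|.
Proof.
transitivity (\sum_(v in [set: V]) #|[set X in edges e | v \in X]|).
  by apply: eq_big => [v|v _]; rewrite ?inE ?degree_edges.
rewrite exchange_count mulnC -sum_nat_const; apply: eq_bigr => X /edge_card.
by rewrite setIT.
Qed.

Local Notation triangles := (triangle_in (edges e)).

Lemma triangleP T : reflect (is_3cycle e T) (T \in triangles).
Proof.
rewrite inE; apply: (iffP andP) => -[].
  move=> /eqP T3 /forall_inP H; split=> // x y xT yT xy.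
  by rewrite -edgesE; have /forall_inP/(_ y yT)/implyP := H x xT; apply.
move=> T3 H; split; first exact/eqP.
apply/forall_inP => x xT; apply/forall_inP => y yT; apply/implyP => xy.
by rewrite edgesE; apply: H.
Qed.

Definition triangles_at v := #|[set T in triangles | v \in T]|.

Lemma sum_triangles_at : \sum_v triangles_at v = 3 * #|triangles|.
Proof.
transitivity (\sum_(v in [set: V]) #|[set X in triangles | v \in X]|).
  by apply: eq_bigl => v; rewrite inE.
rewrite exchange_count mulnC -sum_nat_const; apply: eq_bigr => T /triangleP[T3 _].
by rewrite setIT.
Qed.

Hypothesis e_kite_free : kite_free e.

Lemma triangle_unique T1 T2 x y : e x y -> T1 \in triangles -> T2 \in triangles ->
  x \in T1 -> y \in T1 -> x \in T2 -> y \in T2 -> T1 = T2.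
Proof.
move=> xy /triangleP t1 /triangleP t2 x1 y1 x2 y2; apply/eqP/idPn => ne.
by apply: (e_kite_free t1 t2 ne); exists x, y; rewrite !inE x1 x2 y1 y2.
Qed.

(** Every triangle at [v] uses two edges at [v], and without kites no edge is
    used twice. *)
Lemma triangles_at_degree v : 2 * triangles_at v <= degree e v.
Proof.
pose S := [set T in triangles | v \in T].
have <- : \sum_(w in [set w | e v w]) #|[set T in S | w \in T]| = 2 * triangles_at v.
  rewrite exchange_count mulnC -sum_nat_const; apply: eq_bigr => T.
  case/setIdP => /triangleP[T3 HT] vT.
  have -> : T :&: [set w | e v w] = T :\ v.
    apply/setP => w; rewrite !inE; case: eqVneq => [->|wv] /=.
      by rewrite e_irr andbF.
    by case: (boolP (w \in T)) => //= wT; rewrite HT // eq_sym.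
  by have := cardsD1 v T; rewrite T3 vT => -[].
rewrite /degree -sum1_card; apply: leq_sum => w; rewrite inE => vw.
apply/card_le1_eqP => T1 T2 /setIdP[/setIdP[t1 v1] w1] /setIdP[/setIdP[t2 v2] w2].
exact: (triangle_unique vw).
Qed.

(** Let [A] be a set of vertices all of whose neighbours lie in a set [B] disjoint
    from [A]; in particular no edge joins two vertices of [A].  The graph [star_rel]
    consists of the edges that meet [A] and of the edges that close a triangle with
    a vertex of [A].  Keeping the latter gains an edge for each triangle that meets
    [A], and the triangle costs only half an edge in [planar_bound]. *)
Section Star.
Variable R : realType.
Hypothesis e_planar : planar R e.
Variables A B : {set V}.
Hypothesis AB : [disjoint A & B].
Hypothesis A_nbr : forall a w, a \in A -> e a w -> w \in B.

Definition star_rel : rel V := fun x y => e x y &&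
  [|| x \in A, y \in A | [exists a in A, e a x && e a y]].

Definition triangles_on := [set T in triangles | T :&: A != set0].

Lemma star_sym : symmetric star_rel.
Proof.
move=> x y; rewrite /star_rel e_sym orbCA; congr (_ && (_ || (_ || _))).
by apply: eq_existsb => a; rewrite [e a x && _]andbC.
Qed.

Lemma A_indep x y : e x y -> x \in A -> y \in A = false.
Proof.
by move=> xy xA; apply: (disjointFl AB); apply: A_nbr xA xy.
Qed.

Lemma triangle_A1 T a : T \in triangles -> a \in T -> a \in A -> T :&: A = [set a].
Proof.
move=> /triangleP[_ HT] aT aA; apply/setP => x; rewrite !inE.
have [->|xa] := eqVneq x a; first by rewrite aT aA.
case: (boolP (x \in T)) => //= xT; apply: (@A_indep a) => //.
by apply: HT; rewrite // eq_sym.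
Qed.

Lemma sum_triangles_on : \sum_(a in A) triangles_at a = #|triangles_on|.
Proof.
rewrite exchange_count -sum1_card [LHS]big_mkcond [RHS]big_mkcond.
apply: eq_bigr => T _.
have -> : (T \in triangles_on) = (T \in triangles) && (T :&: A != set0) by rewrite in_set.
case: ifP => //= tT; have [->|] := eqVneq (T :&: A) set0; first by rewrite cards0.
by case/set0Pn => a /setIP[aT aA]; rewrite (triangle_A1 tT aT aA) cards1.
Qed.

(** A triangle that meets [A] does so in one vertex, and it is determined by its
    opposite edge, since two triangles on that edge would form a kite. *)
Lemma star_edges : \sum_(a in A) degree e a + #|triangles_on| <= #|edges star_rel|.
Proof.
pose E1 := [set X in edges e | X :&: A != set0].
pose E2 := [set T :\: A | T in triangles_on].
have i2 : #|E2| = #|triangles_on|.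
  apply: card_in_imset => T1 T2 /setIdP[t1 /set0Pn[a1 /setIP[a1T a1A]]] /setIdP[t2 _] E.
  have /triangleP[T13 H1] := t1.
  have c2 : #|T1 :\: A| = 2.
    by have := cardsID A T1; rewrite (triangle_A1 t1 a1T a1A) cards1 T13; lia.
  have /eqP/cards2P[x [y [xy Exy]]] := c2.
  have : x \in T1 :\: A by rewrite Exy set21.
  have : y \in T1 :\: A by rewrite Exy set22.
  have : x \in T2 :\: A by rewrite -E Exy set21.
  have : y \in T2 :\: A by rewrite -E Exy set22.
  rewrite !inE => /andP[_ y2] /andP[_ x2] /andP[_ y1] /andP[_ x1].
  exact: (triangle_unique (H1 x y x1 y1 xy)).
have c1 : \sum_(a in A) degree e a <= #|E1|.
  under eq_bigr => a _ do rewrite degree_edges.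
  rewrite exchange_count -sum1_card [X in _ <= X]big_mkcond [X in X <= _]big_mkcond /=.
  apply: leq_sum => X _.
  have -> : (X \in E1) = (X \in edges e) && (X :&: A != set0) by rewrite in_set.
  case: ifP => // XE /=.
  have [->|] := eqVneq (X :&: A) set0; first by rewrite cards0.
  case/set0Pn => a; rewrite inE => /andP[aX aA].
  have [w wa EX] := other_end edge_card XE aX.
  rewrite (_ : X :&: A = [set a]) ?cards1 //; apply/setP => x; rewrite !inE.
  have [->|xa] := eqVneq x a; first by rewrite aX aA.
  rewrite EX !inE (negPf xa) /=; case: eqVneq => //= ->.
  by apply: (@A_indep a) => //; rewrite -edgesE -EX.
rewrite -i2; apply: (leq_trans (n := #|E1 :|: E2|)).
  rewrite cardsU (_ : E1 :&: E2 = set0) ?cards0 ?subn0 ?leq_add2r //.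
  apply/setP => X; rewrite !inE; apply/negP => /andP[/andP[_ /set0Pn[a]]].
  by rewrite inE => /andP[aX aA] /imsetP[T _ E]; move: aX; rewrite E inE aA.
apply/subset_leq_card/subsetP => X /setUP[].
  case/setIdP => XE /set0Pn[a /setIP[aX aA]].
  have [w wa EX] := other_end edge_card XE aX.
  by apply/edgesP; exists a, w; split=> //; rewrite /star_rel aA -edgesE -EX XE.
case/imsetP => T /setIdP[tT /set0Pn[a /setIP[aT aA]]] ->; have /triangleP[T3 HT] := tT.
have c2 : #|T :\: A| = 2.
  by have := cardsID A T; rewrite (triangle_A1 tT aT aA) cards1 T3; lia.
have /eqP/cards2P[x [y [xy Exy]]] := c2.
have : x \in T :\: A by rewrite Exy set21.
have : y \in T :\: A by rewrite Exy set22.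
move=> /setDP[yT yA] /setDP[xT xA]; rewrite Exy.
apply/edgesP; exists x, y; split=> //; rewrite /star_rel HT //=.
apply/orP; right; apply/orP; right; apply/exists_inP; exists a => //.
by rewrite !HT //; apply: contraTneq aA => ->.
Qed.

Lemma edges_sub (h : rel V) : subrel h e -> edges h \subset edges e.
Proof.
by move=> he; apply/subsetP => X /edgesP[u [v [/he uv ->]]]; apply/edgesP; exists u, v.
Qed.

(** A triangle of [star_rel] that avoided [A] would share each of its edges with
    a triangle having its third vertex in [A], which makes a kite. *)
Lemma star_triangles : triangle_in (edges star_rel) \subset triangles_on.
Proof.
have sub : subrel star_rel e by move=> x y /andP[].
apply/subsetP => T; rewrite inE => /andP[T3 /forall_inP HT].
have tT : T \in triangles.
  rewrite inE T3; apply/forall_inP => x xT; apply/forall_inP => y yT.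
  apply/implyP => xy; apply: (subsetP (edges_sub sub)).
  by have /forall_inP/(_ y yT)/implyP := HT x xT; apply.
apply/setIdP; split=> //; apply/negP => /eqP T0.
have [x [y [xT yT xy]]] : exists x y, [/\ x \in T, y \in T & x != y].
  by apply/card_gt1P; rewrite (eqP T3).
have nA w : w \in T -> w \in A = false.
  by move=> wT; apply/negP => wA; have := in_set0 w; rewrite -T0 inE wT wA.
have : star_rel x y.
  rewrite -(edges_pair _ _ star_sym).
  by have /forall_inP/(_ y yT)/implyP := HT x xT; apply.
rewrite /star_rel !nA //= => /andP[exy /exists_inP[a aA /andP[eax eay]]].
have ax : a != x by apply: contraTneq aA => ->; rewrite nA.
have ay : a != y by apply: contraTneq aA => ->; rewrite nA.
have t' : [set a; x; y] \in triangles.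
  apply/triangleP; split.
    by rewrite setUC cardsU1 cards2 !inE negb_or ![y == _]eq_sym ay xy ax.
  have h u v : e u v -> e v u by rewrite e_sym.
  move=> u v; rewrite !inE -!orbA.
  by case/or3P => /eqP->; case/or3P => /eqP->; rewrite ?eqxx // => _; apply: h.
have E : [set a; x; y] = T.
  by apply: (triangle_unique exy) => //; rewrite !inE eqxx ?orbT.
by move: aA; rewrite nA // -E !inE eqxx.
Qed.

Lemma star_bound :
  2 * (\sum_(a in A) degree e a) + #|triangles_on| <= 4 * (#|A| + #|B|).
Proof.
have [A0|A0] := eqVneq A set0.
  rewrite A0 big_set0 muln0 add0n (_ : triangles_on = set0) ?cards0 //.
  by apply/setP => T; rewrite !inE A0 setI0 eqxx andbF.
have U0 : A :|: B != set0.
  by apply: contra_neq A0 => /eqP; rewrite setU_eq0 => /andP[/eqP].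
have := @planar_bound R V star_rel (A :|: B) star_sym _ _ U0 _.
have -> : #|A :|: B| = #|A| + #|B|.
  by rewrite cardsU disjoint_setI0 // cards0 subn0.
move=> H; have := star_edges; have := subset_leq_card star_triangles.
suff : 2 * #|edges star_rel| + 4 <= 4 * (#|A| + #|B|) + #|triangle_in (edges star_rel)| by lia.
apply: H.
- by move=> x; rewrite /star_rel e_irr.
- by apply: planar_sub e_planar => x y /andP[].
move=> u v /andP[uv]; rewrite inE; case/or3P => [->//|vA|].
  by rewrite (A_nbr vA) ?orbT // e_sym.
by case/exists_inP => a aA /andP[au _]; rewrite (A_nbr aA au) orbT.
Qed.

End Star.
End Counting.

(** * Discharging *)

Lemma card_sum (V : finType) (A : {set V}) : #|A| = \sum_v (v \in A).
Proof. by rewrite -sum1_card big_mkcond; apply: eq_bigr => v _; case: ifP. Qed.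

(** The balance at a vertex of degree [d] on [t] triangles, where [D] is the
    maximum degree.  On the right stand the edge terms of [planar_bound] for the
    whole graph, taken six times, of [star_bound] for the vertices of degree 3,
    taken twice, and of [star_bound] for the vertices of degree 3 or 4, taken
    once; on the left the vertex terms, and 2 for every triangle at the vertex
    unless [d = 3], where the triangle term of [star_bound] pays.  The bound is
    attained for [d = 3], for [d = 4] and [t = 2], and
    for [d = D = 7] and [t = 3]. *)
Lemma vertex_charge (D d t : nat) : 7 <= D -> d <= D -> 2 * t <= d ->
  (d = 0 \/ 3 <= d) ->
  24 * (0 < d) + 2 * (d != 3) * t + 8 * (d == 3) + 8 * (d == D) + 4 * (2 < d < 5)
    + 4 * (D.-1 <= d)
  <= 6 * d + 12 * (d == 3) + 2 * (2 < d < 5) * d.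
Proof.
move=> D7 dD td [d0|d3]; first by rewrite d0 (_ : t = 0); lia.
have [d4|d5] := ltnP d 5; last first.
  have n3 : (d == 3) = false by lia.
  by rewrite n3 [2 < d]ltnW ?[d < 5]ltnNge ?d5 //=; lia.
have [E|E] : d = 3 \/ d = 4 by lia.
  by rewrite E /=; lia.
by rewrite E /= in td *; lia.
Qed.

(** The two lemmas below have variable coefficients, since numerals would be
    unfolded when the sums are split. *)
Lemma sum_lin3 (I : finType) (a b c : nat) (f g h : I -> nat) :
  \sum_i (a * f i + b * g i + c * h i) =
  a * (\sum_i f i) + b * (\sum_i g i) + c * (\sum_i h i).
Proof. by rewrite !big_split /= -!big_distrr. Qed.

Lemma sum_lin6 (I : finType) (a b c a' b' c' : nat) (f g h f' g' h' : I -> nat) :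
  \sum_i (a * f i + b * g i + c * h i + a' * f' i + b' * g' i + c' * h' i) =
  a * (\sum_i f i) + b * (\sum_i g i) + c * (\sum_i h i) +
  a' * (\sum_i f' i) + b' * (\sum_i g' i) + c' * (\sum_i h' i).
Proof. by rewrite !big_split /= -!big_distrr. Qed.

Theorem theorem7 (R : realType) (V : finType) (e : rel V)
    (e_sym : symmetric e) (e_irr : irreflexive e)
    (e_planar : planar R e) (e_kite_free : kite_free e)
    (maxdeg_ge7 : 7 <= max_degree e) :
  exists u v : V,
    [/\ e u v, degree e u <= 4
      & degree e u + degree e v <= max_degree e + 2].
Proof.
set D := max_degree e in maxdeg_ge7 *.
have dD v : degree e v <= D by exact: (leq_bigmax_cond (F := degree e)).
have [/existsP[u /existsP[v /and3P[uv du duv]]]|no] := boolP [exists u, exists v,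
  [&& e u v, degree e u <= 4 & degree e u + degree e v <= D + 2]].
  by exists u, v.
have light u v : e u v -> degree e u <= 4 -> D + 3 <= degree e u + degree e v.
  move=> uv du; move: no; rewrite negb_exists => /forallP/(_ u).
  by rewrite negb_exists => /forallP/(_ v); rewrite uv du; lia.
have dpos u v : e u v -> 0 < degree e u.
  by move=> uv; apply/card_gt0P; exists v; rewrite inE.
(* The neighbours of a vertex of degree 1 or 2 would have degree above [D]. *)
have d3 v : degree e v = 0 \/ 3 <= degree e v.
  have [->|d0] := posnP (degree e v); first by left.
  right; have /card_gt0P[w] := d0; rewrite inE => vw.
  have := light _ _ vw; have := dD w; lia.
pose U := [set v | 0 < degree e v].
pose A3 := [set v | degree e v == 3].
pose A34 := [set v | 2 < degree e v < 5].
pose B := [set v | degree e v == D].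
pose B' := [set v | D.-1 <= degree e v].
have U0 : U != set0.
  apply: contraTneq maxdeg_ge7 => U0; rewrite -ltnNge /D /max_degree big1 // => v _.
  by have := in_set0 v; rewrite -U0 inE; lia.
have G := planar_bound e_sym e_irr e_planar U0 _.
have {}G : 2 * #|edges e| + 4 <= 4 * #|U| + #|triangle_in (edges e)|.
  by apply: G => u v uv; rewrite inE (dpos u v).
have disj (p q : pred V) : (forall v, p v -> ~~ q v) ->
    [disjoint [set v | p v] & [set v | q v]].
  move=> pq; rewrite disjoint_subset; apply/subsetP => v; rewrite !inE; exact: pq.
have AB : [disjoint A3 & B] by apply: disj => v; lia.
have nAB a w : a \in A3 -> e a w -> w \in B.
  by rewrite !inE => da aw; have := light _ _ aw; have := dD w; lia.
have AB' : [disjoint A34 & B'] by apply: disj => v; lia.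
have nAB' a w : a \in A34 -> e a w -> w \in B'.
  by rewrite !inE => da aw; have := light _ _ aw; have := dD w; lia.
have H3 := star_bound e_sym e_irr e_kite_free e_planar AB nAB.
have H34 := star_bound e_sym e_irr e_kite_free e_planar AB' nAB'.
have T3 := sum_triangles_on e_sym AB nAB.
have E := sum_triangles_at e_sym.
have HS := handshake e_sym e_irr.
(* The three inequalities with multiplicities 6, 2 and 1, vertex by vertex; the
   constant 4 of [planar_bound] makes the sum strict. *)
have : \sum_v (24 * (v \in U) + 2 * ((v \notin A3) * triangles_at e v) + 8 * (v \in A3)
    + 8 * (v \in B) + 4 * (v \in A34) + 4 * (v \in B'))
  <= \sum_v (6 * degree e v + 12 * (v \in A3) + 2 * ((v \in A34) * degree e v)).
  apply: leq_sum => v _; rewrite !inE.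
  have := vertex_charge maxdeg_ge7 (dD v) (triangles_at_degree e_sym e_irr e_kite_free v) (d3 v).
  by rewrite !mulnA.
rewrite sum_lin6 sum_lin3 -!card_sum.
have -> : \sum_v (v \in A34) * degree e v = \sum_(v in A34) degree e v.
  by rewrite [RHS]big_mkcond; apply: eq_bigr => v _; case: ifP => _; rewrite ?mul1n.
have -> : \sum_v (v \notin A3) * triangles_at e v
    = \sum_(v in ~: A3) triangles_at e v.
  rewrite [RHS]big_mkcond; apply: eq_bigr => v _ /=.
  by rewrite in_setC; case: (v \in A3); rewrite ?mul1n.
have : \sum_v triangles_at e v =
    \sum_(v in A3) triangles_at e v + \sum_(v in ~: A3) triangles_at e v.
  rewrite (bigID [in A3]) /=; congr (_ + _); apply: eq_bigl => v.
  by rewrite in_setC.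
have : \sum_(a in A3) degree e a = 3 * #|A3|.
  by rewrite mulnC -sum_nat_const; apply: eq_bigr => v; rewrite inE => /eqP.
lia.
Qed.
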